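(* Let $d\ge 2$ be an integer and $Q_d := (-\pi,\pi)^d$. Let $\psi \in C^\infty(\overline{Q_d})$ be a complex-valued function with zero average, $\int_{Q_d}\psi\,dx=0$, such that $\psi$ and all of its partial derivatives are $2\pi$-periodic in each variable. Assume furthermore that $\psi$ is antisymmetric. Then $$C_{\mathbb{T}}^{as}(d)\int_{Q_d} \frac{|\psi(x)|^2}{\sum_{j=1}^d \sin^2(x_j/2)}\, dx \leq \int_{Q_d} |\nabla \psi(x)|^2\, dx,$$ where $$C_{\mathbb{T}}^{as}(d) := \frac{(d^2-2)^2}{16} \left(1+ \frac{c_d}{C_P^{as}(d)} \right)^{-1},$$ $$c_d := \frac{1}{48d}\left(11 d^4 - 38 d^2 + 12d +12\right),\qquad C_P^{as}(d) := \frac{N(N-1)(2N-1)}{3} + \frac{(3-(-1)^d)N^2}{2},\qquad N := \lfloor d/2 \rfloor .$$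
   Context: A map $g:\overline{Q_d}\to\mathbb{C}$ is $2\pi$-periodic in each variable if $g(x_1,\dots,x_{i-1},-\pi,x_{i+1},\dots,x_d)=g(x_1,\dots,x_{i-1},\pi,x_{i+1},\dots,x_d)$ for all $1\le i\le d$ (and all values of the other coordinates in $[-\pi,\pi]$). A function $\psi$ is antisymmetric if $\psi(\dots,x_j,\dots,x_i,\dots) = -\psi(\dots,x_i,\dots,x_j,\dots)$ for all $1\le i\neq j\le d$, i.e. interchanging any two coordinates of the argument changes the sign of $\psi$. $C^\infty(\overline{Q_d})$ denotes functions smooth up to the boundary. *)

(* Defs.v *)
From HB Require Import structures.
From mathcomp Require Import all_boot all_order all_algebra.
From mathcomp Require Import all_classical all_reals all_analysis.
From mathcomp Require Import complex.

Set Implicit Arguments.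
Unset Strict Implicit.
Unset Printing Implicit Defensive.

Import Order.TTheory GRing.Theory Num.Theory.
Import numFieldNormedType.Exports.

Local Open Scope classical_set_scope.
Local Open Scope ring_scope.

(** Row vectors carry the sigma-algebra generated by their coordinates; over a
    [realType] this is the Borel sigma-algebra of R^n. *)
Section measurable_rV.
Context d (T : sigmaRingType d) (n : nat).

Let coord (i : 'I_n) (x : 'rV[T]_n) : T := x ord0 i.

Let rV_set0 : g_sigma_preimage coord set0.
Proof. exact: sigma_algebra0. Qed.

Let rV_setC A : g_sigma_preimage coord A -> g_sigma_preimage coord (~` A).
Proof. exact: sigma_algebraC. Qed.

Let rV_bigcup (F : _^nat) : (forall i, g_sigma_preimage coord (F i)) ->
  g_sigma_preimage coord (\bigcup_i (F i)).
Proof. exact: sigma_algebra_bigcup. Qed.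

HB.instance Definition _ := @isMeasurable.Build (measure_tuple_display d)
  'rV[T]_n (g_sigma_preimage coord) rV_set0 rV_setC rV_bigcup.

End measurable_rV.

Lemma measurable_coord d (T : measurableType d) n (i : 'I_n) :
  measurable_fun [set: 'rV[T]_n] (fun x : 'rV[T]_n => x ord0 i).
Proof.
move=> _ Y mY; rewrite setTI; apply: sub_sigma_algebra => /=.
rewrite -bigcup_seq/=; exists i => /=; first by rewrite mem_index_enum.
by exists Y => //; rewrite setTI.
Qed.

Lemma measurable_fun_rV d1 d2 (T1 : measurableType d1) (T2 : measurableType d2)
    n (f : T1 -> 'rV[T2]_n) :
  (forall i, measurable_fun [set: T1] (fun t => f t ord0 i)) ->
  measurable_fun [set: T1] f.
Proof.
move=> mf; pose coord (i : 'I_n) (x : 'rV[T2]_n) := x ord0 i.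
have prefS : g_sigma_preimage (fun i => coord i \o f) `<=` measurable.
  apply: smallest_sub; first exact: sigma_algebra_measurable.
  rewrite -bigcup_seq/= => A [i _] [B mB <-]; exact: mf.
rewrite g_sigma_preimage_comp in prefS.
by move=> _ A mA; apply: prefS; exists A.
Qed.

Section lebesgue_rV.
Context (R : realType).
Local Open Scope ereal_scope.

Local Notation RR := (measurableTypeR R).

Definition cons_rV n (p : RR * 'rV[RR]_n) : 'rV[RR]_n.+1 :=
  row_mx (const_mx p.1 : 'rV[RR]_1) p.2.

Lemma cons_rV0 n (p : RR * 'rV[RR]_n) : cons_rV p ord0 ord0 = p.1.
Proof. by rewrite mxE; case: splitP => // j _; rewrite mxE. Qed.

Lemma cons_rV_lift n (p : RR * 'rV[RR]_n) j :
  cons_rV p ord0 (lift ord0 j) = p.2 ord0 j.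
Proof.
have -> : lift ord0 j = rshift 1 j by exact/val_inj.
exact: row_mxEr.
Qed.

Lemma measurable_cons_rV n : measurable_fun [set: _] (@cons_rV n).
Proof.
apply: measurable_fun_rV => i; have [j ->|->] := unliftP ord0 i.
- under eq_fun do rewrite cons_rV_lift.
  exact: (measurableT_comp (measurable_coord j) measurable_snd).
- under eq_fun do rewrite cons_rV0.
  exact: measurable_fst.
Qed.

Section step.
Context n (mu : {sigma_finite_measure set 'rV[RR]_n -> \bar R}).

Definition lebesgue_rVS : set 'rV[RR]_n.+1 -> \bar R :=
  pushforward (@lebesgue_measure R \x mu) (@cons_rV n).

Let mcons := @measurable_cons_rV n.

Let lebesgue_rVS0 : lebesgue_rVS set0 = 0. Proof. exact: measure0. Qed.

Let lebesgue_rVS_ge0 A : 0 <= lebesgue_rVS A. Proof. exact: measure_ge0. Qed.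

Let lebesgue_rVS_sigma_additive : semi_sigma_additive lebesgue_rVS.
Proof. exact: measure_semi_sigma_additive. Qed.

HB.instance Definition _ := isMeasure.Build _ _ _ lebesgue_rVS
  lebesgue_rVS0 lebesgue_rVS_ge0 lebesgue_rVS_sigma_additive.

Let lebesgue_rVS_sigma_finite : sigma_finite setT lebesgue_rVS.
Proof.
have /sigma_finiteP[F [TF ndF Foo]] := sigma_finiteT (@lebesgue_measure R).
have /sigma_finiteP[G [TG ndG Goo]] := sigma_finiteT mu.
pose tail (x : 'rV[RR]_n.+1) : 'rV[RR]_n := (\row_j x ord0 (lift ord0 j))%R.
have mtail : measurable_fun setT tail.
  apply: measurable_fun_rV => i; under eq_fun do rewrite mxE.
  exact: measurable_coord.
have tailK p : tail (cons_rV p) = p.2.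
  by apply/rowP => j; rewrite mxE cons_rV_lift.
exists (fun k => [set x : 'rV[RR]_n.+1 | F k (x ord0 ord0)] `&` tail @^-1` G k).
  apply/esym; rewrite -subTset => x _.
  have [i _ Fi] : (\bigcup_i F i) (x ord0 ord0) by rewrite -TF.
  have [j _ Gj] : (\bigcup_i G i) (tail x) by rewrite -TG.
  exists (maxn i j) => //; split.
  - by have /subsetPset := ndF _ _ (leq_maxl i j); exact.
  - by have /subsetPset := ndG _ _ (leq_maxr i j); exact.
move=> k; have [mF Fk] := Foo k; have [mG Gk] := Goo k; split.
  apply: measurableI; rewrite -[X in measurable X]setTI; last exact: mtail.
  exact: measurable_coord.
rewrite /lebesgue_rVS /pushforward (_ : _ @^-1` _ = F k `*` G k).
  by rewrite product_measure1E// lte_mul_pinfty// ge0_fin_numE.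
by apply/seteqP; split => p /=; rewrite tailK cons_rV0.
Qed.

HB.instance Definition _ :=
  Measure_isSigmaFinite.Build _ _ _ lebesgue_rVS lebesgue_rVS_sigma_finite.

End step.

Fixpoint lebesgue_rV n : {sigma_finite_measure set 'rV[RR]_n -> \bar R} :=
  if n is n'.+1 then lebesgue_rVS (lebesgue_rV n') else \d_(0%R : 'rV[RR]_0).

Lemma lebesgue_rV_box n (A : 'I_n -> set RR) :
  (forall i, measurable (A i)) ->
  lebesgue_rV n [set x : 'rV[RR]_n | forall i, A i (x ord0 i)] =
  \prod_(i < n) lebesgue_measure (A i).
Proof.
elim: n A => [|n IHn] A mA.
  by rewrite big_ord0 /= diracE mem_set// => -[].
have mB : measurable
    [set x : 'rV[RR]_n | forall i, A (lift ord0 i) (x ord0 i)].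
  rewrite (_ : [set _ | _] = \bigcap_(i in [set: 'I_n])
      (fun x : 'rV[RR]_n => x ord0 i) @^-1` A (lift ord0 i)).
    apply: fin_bigcap_measurable => // i _; rewrite -[X in measurable X]setTI.
    exact: measurable_coord.
  by apply/seteqP; split => x /= Ax i => [_|]; exact: Ax.
rewrite big_ord_recl -IHn// -product_measure1E//.
rewrite /= /lebesgue_rVS /pushforward; congr (_ _).
apply/seteqP; split => -[x y] /=.
  move=> Axy; split=> [|i]; first by have := Axy ord0; rewrite cons_rV0.
  by have := Axy (lift ord0 i); rewrite cons_rV_lift.
move=> [Ax Ay] i; have [j ->|->] := unliftP ord0 i.
  by rewrite cons_rV_lift; exact: Ay.
by rewrite cons_rV0.
Qed.

End lebesgue_rV.

Section torus.
Context (R : realType) (d : nat).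
Implicit Types (psi g : 'rV[R]_d -> R[i]) (x : 'rV[R]_d).

Definition cube : set 'rV[R]_d := [set x | forall j, - pi < x ord0 j < pi].

Definition ccube : set 'rV[R]_d := [set x | forall j, - pi <= x ord0 j <= pi].

(** Continuity, differentiation and integration of complex-valued functions
    are taken componentwise, R[i] carrying no topology in the library. *)
Definition continuous_on (A : set 'rV[R]_d) g : Prop :=
  {within A, continuous (fun x => complex.Re (g x))} /\
  {within A, continuous (fun x => complex.Im (g x))}.

Definition dirv (j : 'I_d) : 'rV[R]_d := delta_mx ord0 j.

Definition pderivable g x j : Prop :=
  derivable (fun y => complex.Re (g y)) x (dirv j) /\
  derivable (fun y => complex.Im (g y)) x (dirv j).

Definition pderiv (j : 'I_d) g x : R[i] :=
  ('D_(dirv j) (fun y => complex.Re (g y)) x +i*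
   'D_(dirv j) (fun y => complex.Im (g y)) x)%C.

(** [pderivs [:: j1; ...; jk] psi] is the partial derivative
    d_j1 (... (d_jk psi)). *)
Definition pderivs (s : seq 'I_d) psi : 'rV[R]_d -> R[i] :=
  foldr pderiv psi s.

(** [g] is the continuous extension of [f] from the open to the closed cube; it
    is unique on the closed cube. The values of [f] and [g] outside of their
    respective cubes are irrelevant. *)
Definition ccube_extension (f g : 'rV[R]_d -> R[i]) : Prop :=
  continuous_on ccube g /\ forall x, cube x -> f x = g x.

(** C^oo up to the boundary: [psi] is continuous on the closed cube, and all its
    iterated partial derivatives exist in the open cube and extend continuously
    to the closed cube. *)
Definition smooth_ccube psi : Prop :=
  continuous_on ccube psi /\
  forall s : seq 'I_d,
    (forall x j, cube x -> pderivable (pderivs s psi) x j) /\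
    exists g, ccube_extension (pderivs s psi) g.

Definition set_coord x (i : 'I_d) (t : R) : 'rV[R]_d :=
  \row_j (if j == i then t else x ord0 j).

Definition periodic_ccube g : Prop :=
  forall i x, ccube x -> g (set_coord x i (- pi)) = g (set_coord x i pi).

(** On the faces of the cube a partial derivative is its continuous extension. *)
Definition periodic_pderivs psi : Prop :=
  forall s g, ccube_extension (pderivs s psi) g -> periodic_ccube g.

Definition antisymmetric_ccube psi : Prop :=
  forall (i j : 'I_d) x, i != j -> ccube x -> psi (xcol i j x) = - psi x.

Definition cube_Cintegral psi : R[i] :=
  ((\int[lebesgue_rV R d]_(x in cube) complex.Re (psi x))%R +i*
   (\int[lebesgue_rV R d]_(x in cube) complex.Im (psi x))%R)%C.

Definition sqnorm (z : R[i]) : R := ComplexField.Normc.normc z ^+ 2.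

Definition sqnorm_grad psi x : R := \sum_(j < d) sqnorm (pderiv j psi x).

End torus.

Section constants.
Context (R : realType) (d : nat).

Definition c_d : R :=
  (48 * d%:R)^-1 * (11 * d%:R ^+ 4 - 38 * d%:R ^+ 2 + 12 * d%:R + 12).

Definition C_P_as : R :=
  let N : R := (d./2)%:R in
  N * (N - 1) * (2 * N - 1) / 3 + (3 - (- 1) ^+ d) * N ^+ 2 / 2.

Definition C_T_as : R :=
  (d%:R ^+ 2 - 2) ^+ 2 / 16 * (1 + c_d / C_P_as)^-1.

End constants.

(* Main.v *)
Require Import Defs.
From mathcomp Require Import all_boot all_order all_algebra.
From mathcomp Require Import all_classical all_reals all_analysis.
From mathcomp Require Import complex.
From mathcomp Require Import ring lra measurable_realfun.

(** Let [w] be the sum of the [sin (x_j / 2) ^+ 2]. The proof compares an antisymmetric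
    function with the explicit antisymmetric function
<<
      phi = V * w ^- a,     V = \prod_(i < j) sin ((x_i - x_j) / 2).
>>
    Writing [F] for the gradient of [ln phi], the pointwise inequality
    [0 <= |grad u - u F| ^+ 2] and the divergence theorem on the torus give, for
    real [u],
<<
      \int (- div F - |F| ^+ 2) u ^+ 2 <= \int |grad u| ^+ 2,
>>
    and [- div F - |F| ^+ 2 = - Laplacian phi / phi] is computed exactly in
    [potentialE]:
<<
      d (d^2 - 1) / 12 - a d + a (d^2 / 2 - 1 - a) / w
        + a (a + 1) (\sum_j sin (x_j / 2) ^+ 4) / w ^+ 2.
>>
    The last quotient is at least [1 / d] by Cauchy--Schwarz. The choice
    [a = (d^2 - 2) / 4] maximises the coefficient of [1 / w] and gives the Hardy
    term with the factor [(d^2 - 2)^2 / 16], up to a negative multiple of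
    [\int u ^+ 2]; the choice [a = 0] gives the spectral gap [d (d^2 - 1) / 12], which
    absorbs that multiple. The constant so obtained is at least [C_T_as]
    ([hardy_constant_le]).

    The field [F] is singular where two coordinates agree modulo [2 * pi], and at
    the origin. It is replaced by the smooth periodic field [drift e], to which the
    divergence theorem applies ([supersolution_ineq]). Antisymmetry and periodicity
    force [u ^+ 2 <= K * (1 - cos (x_i - x_j))] ([C1_antisym_vanish]), and this makes
    the integrands bounded uniformly in [e] ([drift_bounded]), so that dominated
    convergence yields the inequality for [e = 0] ([cot_potential_ineq]). The
    divergence theorem reduces to the fundamental theorem of calculus in one
    variable by Fubini's theorem ([integral_cube_slices0]). Complex functions are
    treated through their real and imaginary parts. *)

Set Implicit Arguments.
Unset Strict Implicit.
Unset Printing Implicit Defensive.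

Import Order.TTheory GRing.Theory Num.Theory.
Import numFieldNormedType.Exports.

Local Open Scope classical_set_scope.
Local Open Scope ring_scope.

(** * Trigonometric identities and the ground-state potential *)

Section trigonometry.
Context {R : realType}.
Implicit Types (t e : R).

(** A regularisation of [cot (t / 2) = sin t / (1 - cos t)], smooth and periodic
    for [0 < e]. *)
Definition rcot e t : R := sin t / (1 - cos t + e).

Definition rcot' e t : R :=
  (cos t * (1 - cos t + e) - sin t ^+ 2) / (1 - cos t + e) ^+ 2.

Lemma half_angle t :
  sin t = 2 * sin (t / 2) * cos (t / 2) /\ 1 - cos t = 2 * sin (t / 2) ^+ 2.
Proof.
have -> : sin t = sin (t / 2 *+ 2) by congr sin; field.
have -> : cos t = cos (t / 2 *+ 2) by congr cos; field.
rewrite sin_mulr2n cos_mulr2n; have E := cos2Dsin2 (t / 2).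
by split; [ring|lra].
Qed.

Lemma rcot0E t : rcot 0 t = cos (t / 2) / sin (t / 2).
Proof.
have [s c] := half_angle t; rewrite /rcot addr0 s c.
have [->|s0] := eqVneq (sin (t / 2)) 0; first by rewrite !(mulr0, mul0r, invr0).
by field.
Qed.

Lemma rcotN t : rcot 0 (- t) = - rcot 0 t.
Proof. by rewrite /rcot sinN cosN mulNr. Qed.

Lemma rcot'0E t : cos t != 1 -> rcot' 0 t = - (1 + rcot 0 t ^+ 2) / 2.
Proof.
move=> c1; have c0 : 1 - cos t != 0 by rewrite subr_eq0 eq_sym.
rewrite /rcot' /rcot addr0 expr_div_n sin2cos2; field; exact: c0.
Qed.

Lemma cos_neq1_sin_half t : cos t != 1 -> sin (t / 2) != 0.
Proof.
apply: contra => /eqP s0; rewrite eq_sym -subr_eq0.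
by have [_ ->] := half_angle t; rewrite s0 expr0n mulr0.
Qed.

(** The cotangent addition formula, written symmetrically in the three angles. *)
Lemma rcot_triple a b : cos a != 1 -> cos b != 1 -> cos (a + b) != 1 ->
  rcot 0 a * rcot 0 (a + b) - rcot 0 a * rcot 0 b + rcot 0 b * rcot 0 (a + b)
    = - 1.
Proof.
move=> /cos_neq1_sin_half a0 /cos_neq1_sin_half b0 /cos_neq1_sin_half.
rewrite !rcot0E mulrDl sinD cosD => ab0; field.
by rewrite a0 b0 ab0.
Qed.

Lemma rcot_sinB a b : cos (a - b) != 1 ->
  rcot 0 (a - b) * (sin a - sin b) = cos a + cos b.
Proof.
move=> c1; have c0 : 1 - cos (a - b) != 0 by rewrite subr_eq0 eq_sym.
rewrite /rcot addr0 mulrAC; apply: (mulIf c0); rewrite divfK//.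
rewrite sinB cosB.
have Ea := cos2Dsin2 a; have Eb := cos2Dsin2 b.
have -> : (sin a * cos b - cos a * sin b) * (sin a - sin b) =
  cos b * (cos a ^+ 2 + sin a ^+ 2 - cos a ^+ 2)
  + cos a * (cos b ^+ 2 + sin b ^+ 2 - cos b ^+ 2)
  - sin a * sin b * (cos a + cos b) by ring.
by rewrite Ea Eb; ring.
Qed.

End trigonometry.

Section potential.
Context {R : realType} {d : nat}.
Implicit Types (x : 'rV[R]_d) (e g : R) (i j : 'I_d).

(** The sum of the [sin (x_j / 2) ^+ 2], in the form that is simplest to
    differentiate. *)
Definition hardy_weight x : R := \sum_j (1 - cos (x ord0 j)) / 2.

(** For [e = 0], the [j]-th partial derivative of [ln phi], where
    [phi = \prod_(i < j) sin ((x_i - x_j) / 2) * w ^- g] and [w] is the Hardy weight. *)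
Definition drift e g j x : R :=
  (\sum_(i | i != j) rcot e (x ord0 j - x ord0 i)) / 2
  - g / 2 * (sin (x ord0 j) / (hardy_weight x + e)).

(** The partial derivative of [drift e g j] in its own direction [j]: the sum over
    [j] is the divergence of the drift. *)
Definition drift' e g j x : R :=
  (\sum_(i | i != j) rcot' e (x ord0 j - x ord0 i)) / 2
  - g / 2 * ((cos (x ord0 j) * (hardy_weight x + e) - sin (x ord0 j) ^+ 2 / 2)
             / (hardy_weight x + e) ^+ 2).

Lemma hardy_weight_ge0 x : 0 <= hardy_weight x.
Proof. by apply: sumr_ge0 => j _; have := cos_le1 (x ord0 j); lra. Qed.

Section at_point.
Variable x : 'rV[R]_d.
Hypothesis cx : forall i j, i != j -> cos (x ord0 i - x ord0 j) != 1.

Let k i j : R := rcot 0 (x ord0 i - x ord0 j).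
Let S j : R := sin (x ord0 j).
Let C j : R := cos (x ord0 j).
Let w : R := hardy_weight x.
Let Q : R := \sum_j \sum_i k j i ^+ 2.
Let N : R := d%:R.

Let kii i : k i i = 0.
Proof. by rewrite /k subrr /rcot sin0 mul0r. Qed.

Let kN i j : k i j = - k j i.
Proof. by rewrite /k -rcotN opprB. Qed.

Let dl i j : R := (i == j)%:R.

Let sum_dl j (f : 'I_d -> R) : \sum_i dl i j * f i = f j.
Proof.
rewrite (bigD1 j)//= big1 ?addr0 => [|i /negbTE ij]; first by rewrite /dl eqxx mul1r.
by rewrite /dl ij mul0r.
Qed.

Let sum_const (c : R) : \sum_(i < d) c = N * c.
Proof. by rewrite sumr_const card_ord -[in LHS]mulr_natl. Qed.

Let sum_k2 i : \sum_j k i j ^+ 2 = \sum_j k j i ^+ 2.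
Proof. by apply: eq_bigr => j _; rewrite kN sqrrN. Qed.

(** Summed over the three ways to single out one of the indices, the product of
    two cotangents is [- 1] on triples of distinct indices; the other terms
    account for coincidences, where [k] takes the value [0]. *)
Let triple j i l :
  k j i * k j l + k i j * k i l + k l i * k l j =
  - (1 - dl i j) * (1 - dl l j) * (1 - dl l i)
  + dl i j * k l j ^+ 2 + dl l j * k i j ^+ 2 + dl l i * k i j ^+ 2.
Proof.
rewrite /dl.
have [->|ij] := eqVneq i j.
  rewrite kii; have [->|lj] := eqVneq l j; first by rewrite kii !(mulr0n, mulr1n); ring.
  by rewrite !(mulr0n, mulr1n); ring.
have [->|lj] := eqVneq l j.
  by rewrite kii [j == i]eq_sym (negbTE ij) !(mulr0n, mulr1n) (kN j i); ring.
have [->|li] := eqVneq l i.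
  rewrite kii !(mulr0n, mulr1n) (kN j i). ring.
have := @rcot_triple R (x ord0 j - x ord0 i) (x ord0 i - x ord0 l).
rewrite subrKA => H; have {}H := H (cx _) (cx _) (cx _); move: H.
have [ji il jl] : [/\ j != i, i != l & j != l] by rewrite ![_ == l]eq_sym [j == i]eq_sym.
move=> /(_ ji il jl).
rewrite -/(k j i) -/(k j l) -/(k i l) => E.
rewrite (kN i j) (kN l i) (kN l j) !(mulr0n, mulr1n); lra.
Qed.

Let sum_k_sqr : \sum_j (\sum_i k j i) ^+ 2 = Q - N * (N - 1) * (N - 2) / 3.
Proof.
pose T := \sum_j \sum_i \sum_l k j i * k j l.
have ET : \sum_j (\sum_i k j i) ^+ 2 = T.
  apply: eq_bigr => j _; rewrite expr2 mulr_suml; apply: eq_bigr => i _.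
  by rewrite mulr_sumr.
have T2 : T = \sum_j \sum_i \sum_l k i j * k i l by rewrite /T exchange_big.
have T3 : T = \sum_j \sum_i \sum_l k l i * k l j.
  rewrite {1}/T; under eq_bigr do rewrite exchange_big/=.
  rewrite exchange_big; apply: eq_bigr => j _; rewrite exchange_big.
  by apply: eq_bigr => i _; apply: eq_bigr => l _; rewrite mulrC.
have : T + T + T = 3 * Q - N * (N - 1) * (N - 2).
  rewrite {2}T2 {2}T3 /T -!big_split/=.
  transitivity (\sum_(j < d) (3 * (\sum_i k i j ^+ 2) - (N - 1) * (N - 2))).
    apply: eq_bigr => j _; rewrite -!big_split/=.
    under eq_bigr => i _ do rewrite -!big_split/=.
    under eq_bigr => i _.
      under eq_bigr => l _ do rewrite triple.
      over.
    have -> : \sum_i \sum_l (- (1 - dl i j) * (1 - dl l j) * (1 - dl l i)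
        + dl i j * k l j ^+ 2 + dl l j * k i j ^+ 2 + dl l i * k i j ^+ 2) =
      \sum_i (- (1 - dl i j) * (N - 1 - 1 + dl i j) +
         dl i j * (\sum_l k l j ^+ 2) + k i j ^+ 2 + k i j ^+ 2).
      apply: eq_bigr => i _; rewrite !big_split/=.
      rewrite -mulr_sumr !sum_dl; congr (_ + _ + _ + _).
      under eq_bigr do rewrite -mulrA.
      rewrite -mulr_sumr; congr (_ * _).
      transitivity (\sum_(l < d) (1 - dl l j * 1 - dl l i * 1 + dl l j * dl l i)).
        by apply: eq_bigr => l _; ring.
      by rewrite !big_split/= !sumrN !sum_dl sum_const mulr1 /dl [j == i]eq_sym.
    rewrite !big_split/= !sum_dl.
    have -> : \sum_i - (1 - dl i j) * (N - 1 - 1 + dl i j) =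
       \sum_i (- (N - 2) + dl i j * (N - 3) + dl i j * dl i j).
      by apply: eq_bigr => i _; ring.
    rewrite !big_split/= !sum_dl sum_const /dl eqxx mulr1n; ring.
  rewrite sumrB sum_const -mulr_sumr /Q; congr (_ * _ - _); last by ring.
  by apply: eq_bigr => j _; rewrite sum_k2.
rewrite ET; lra.
Qed.

Let sum_C : \sum_j C j = N - 2 * w.
Proof.
rewrite /w /hardy_weight mulr_sumr.
rewrite -[N]mulr1 -sum_const -sumrB; apply: eq_bigr => j _; by rewrite /C; field.
Qed.

Let sum_S_k : \sum_j S j * (\sum_i k j i) = (N - 1) * (N - 2 * w).
Proof.
pose T := \sum_j \sum_i S j * k j i.
have -> : \sum_j S j * (\sum_i k j i) = T.
  by apply: eq_bigr => j _; rewrite mulr_sumr.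
have T2 : T = \sum_j \sum_i S i * k i j by rewrite /T exchange_big.
have : T + T = 2 * ((N - 1) * (N - 2 * w)).
  rewrite {2}T2 /T -big_split/=.
  transitivity (\sum_j (N * C j + (N - 2 * w) - 2 * C j)).
    apply: eq_bigr => j _; rewrite -big_split/=.
    transitivity (\sum_i (C j + C i - dl i j * (2 * C j))).
      apply: eq_bigr => i _; rewrite /dl; have [->|ij] := eqVneq.
        by rewrite kii mulr1n; ring.
      rewrite mulr0n mul0r subr0 (kN i j).
      rewrite -(@rcot_sinB R (x ord0 j) (x ord0 i)) ?cx 1?eq_sym//.
      rewrite -/(k j i) -/(S j) -/(S i); ring.
    by rewrite sumrB big_split/= sum_const sum_C sum_dl.
  rewrite sumrB big_split/= -!mulr_sumr sum_const sum_C; ring.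
lra.
Qed.

Let Sg : R := \sum_j ((1 - C j) / 2) ^+ 2.

Let sum_S2 : \sum_j S j ^+ 2 = 4 * w - 4 * Sg.
Proof.
rewrite /w /hardy_weight /Sg !mulr_sumr -sumrB; apply: eq_bigr => j _.
by rewrite /S sin2cos2 /C; field.
Qed.

(** The left-hand side is [- Laplacian phi / phi]. The squares of the cotangents in
    the divergence cancel those in the square of the drift, the products of two
    different ones sum to a constant by [triple], and the cross terms with the
    weight reduce by [rcot_sinB] to sums of cosines. *)
Lemma potentialE g : w != 0 ->
  \sum_j (- drift' 0 g j x - drift 0 g j x ^+ 2) =
  N * (N ^+ 2 - 1) / 12 - g * N + g * (N ^+ 2 / 2 - 1 - g) / w
  + g * (g + 1) * (Sg / w ^+ 2).
Proof.
move=> w0.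
have D1 : \sum_j (\sum_(i | i != j) rcot' 0 (x ord0 j - x ord0 i)) =
    - (N * (N - 1) + Q) / 2.
  transitivity (\sum_j (- (N - 1 + \sum_i k j i ^+ 2) / 2)).
    apply: eq_bigr => j _.
    transitivity (\sum_(i | i != j) (- (1 + k j i ^+ 2) / 2)).
      by apply: eq_bigr => i ij; rewrite rcot'0E// cx// eq_sym.
    have : \sum_i (- (1 + k j i ^+ 2) / 2) = - (1 + k j j ^+ 2) / 2 +
        \sum_(i | i != j) (- (1 + k j i ^+ 2) / 2) by rewrite (bigD1 j).
    rewrite -mulr_suml sumrN big_split/= sum_const kii.
    lra.
  rewrite -mulr_suml sumrN big_split/= sum_const -/Q; ring.
have F1 j : \sum_(i | i != j) rcot 0 (x ord0 j - x ord0 i) = \sum_i k j i.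
  by rewrite [RHS](bigD1 j)//= kii add0r.
transitivity (- (- (N * (N - 1) + Q) / 2) / 2
   + g / 2 * ((\sum_j C j) / w - (\sum_j S j ^+ 2) / (2 * w ^+ 2))
   - ((\sum_j (\sum_i k j i) ^+ 2) / 4
      - g / (2 * w) * (\sum_j S j * (\sum_i k j i))
      + g ^+ 2 / (4 * w ^+ 2) * \sum_j S j ^+ 2)); last first.
  rewrite sum_k_sqr sum_S_k sum_S2 sum_C; field.
  by rewrite w0.
rewrite -D1.
transitivity (\sum_j ((- 1 / 2) * (\sum_(i | i != j) rcot' 0 (x ord0 j - x ord0 i))
  + g / (2 * w) * C j - (g / (4 * w ^+ 2) + g ^+ 2 / (4 * w ^+ 2)) * S j ^+ 2
  - 1 / 4 * (\sum_i k j i) ^+ 2 + g / (2 * w) * (S j * \sum_i k j i))).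
  apply: eq_bigr => j _; rewrite /drift /drift' F1 -/w -/(S j) -/(C j) !addr0.
  by field.
by rewrite !(big_split, sumrN)/= -!mulr_sumr; field.
Qed.

End at_point.

End potential.

(** * Bounds uniform in the regularisation, and convergence *)

Section bounds.
Context {R : realType} {d : nat}.
Implicit Types (x : 'rV[R]_d) (e g t v K : R) (i j : 'I_d).

(** Cauchy--Schwarz against a constant vector. *)
Lemma sum_sqr_ge (a : 'I_d -> R) :
  (\sum_j a j) ^+ 2 <= d%:R * \sum_j a j ^+ 2.
Proof.
have [d0|d_gt0] := posnP d.
  have a0 (b : 'I_d -> R) : \sum_j b j = 0.
    by apply: big1 => -[m Hm] _; exfalso; move: Hm; rewrite d0.
  by rewrite !a0 expr0n mulr0.
set A := \sum_j a j; set B := \sum_j a j ^+ 2.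
have N0 : 0 < d%:R :> R by rewrite ltr0n.
have : 0 <= \sum_j (d%:R * a j - A) ^+ 2 by apply: sumr_ge0 => j _; exact: sqr_ge0.
have -> : \sum_j (d%:R * a j - A) ^+ 2 =
    \sum_j (d%:R ^+ 2 * a j ^+ 2 - 2 * A * d%:R * a j + A ^+ 2).
  by apply: eq_bigr => j _; ring.
rewrite !(big_split, sumrN)/= sumr_const card_ord -[A ^+ 2 *+ d]mulr_natl.
rewrite -!mulr_sumr -/A -/B.
have -> : d%:R ^+ 2 * B - 2 * A * d%:R * A + d%:R * A ^+ 2 =
   d%:R * (d%:R * B - A ^+ 2) by ring.
by rewrite pmulr_rge0// subr_ge0.
Qed.

Lemma sum_neq_sqr_le (a : 'I_d -> R) j c : (forall i, i != j -> a i ^+ 2 <= c) ->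
  0 <= c -> (\sum_(i | i != j) a i) ^+ 2 <= d%:R ^+ 2 * c.
Proof.
move=> ac c0; rewrite big_mkcond/=; apply: (le_trans (sum_sqr_ge _)).
rewrite expr2 -mulrA ler_wpM2l// mulr_natl -[X in _ *+ X]card_ord -sumr_const.
by apply: ler_sum => i _; case: ifPn => [/ac//|_]; rewrite expr0n.
Qed.

Lemma sum_neq_norm_le (a : 'I_d -> R) j c : (forall i, i != j -> `|a i| <= c) ->
  0 <= c -> `|\sum_(i | i != j) a i| <= d%:R * c.
Proof.
move=> ac c0; rewrite big_mkcond/=; apply: (le_trans (ler_norm_sum _ _ _)).
rewrite mulr_natl -[X in _ *+ X]card_ord -sumr_const.
by apply: ler_sum => i _; case: ifPn => [/ac//|_]; rewrite normr0.
Qed.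

(** The squared regularised cotangent, and its derivative, blow up at most like
    the inverse of [1 - cos t], whatever the regularisation. *)
Lemma rcot_sqr_le e t v K : 0 < e -> 0 <= K -> 0 <= v <= K * (1 - cos t) ->
  rcot e t ^+ 2 * v <= 2 * K.
Proof.
move=> e0 K0 /andP[v0 vK]; have c1 := cos_geN1 t.
have q0 : 0 <= 1 - cos t by rewrite subr_ge0 cos_le1.
rewrite /rcot expr_div_n sin2cos2 mulrAC.
have -> : 1 - cos t ^+ 2 = (1 - cos t) * (1 + cos t) by ring.
have c2 : 1 + cos t = 2 - (1 - cos t) by ring.
rewrite {}c2; move: (1 - cos t) q0 vK => q q0 vK.
have qe0 : 0 < q + e by lra.
rewrite ler_pdivrMr ?exprn_gt0//.
have h1 : q * v <= q * (K * q) by rewrite ler_wpM2l.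
have h2 : 0 <= q * q * v by rewrite !mulr_ge0.
have h3 : 0 <= K * (q * e) by rewrite !mulr_ge0// ltW.
have h4 : 0 <= K * e ^+ 2 by rewrite mulr_ge0// sqr_ge0.
lra.
Qed.

Lemma rcot'_norm_le e t v K : 0 < e -> 0 <= K -> 0 <= v <= K * (1 - cos t) ->
  `|rcot' e t| * v <= 3 * K.
Proof.
move=> e0 K0 /andP[v0 vK]; have c1 := cos_geN1 t; have c2 := cos_le1 t.
rewrite /rcot' normrM normfV sin2cos2.
have -> : 1 - cos t ^+ 2 = (1 - cos t) * (2 - (1 - cos t)) by ring.
have q0 : 0 <= 1 - cos t by rewrite subr_ge0 cos_le1.
have : cos t = 1 - (1 - cos t) by ring.
move: (cos t) (1 - cos t) q0 vK c1 c2 => c q q0 vK c1 c2 cq.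
have qe0 : 0 < q + e by lra.
rewrite [`|_ ^+ 2|]ger0_norm ?sqr_ge0//.
rewrite mulrAC ler_pdivrMr ?exprn_gt0//.
have num : `|c * (q + e) - q * (2 - q)| <= 3 * (q + e).
  rewrite ler_norml; apply/andP; split; nra.
have h1 : v <= K * (q + e).
  by apply: (le_trans vK); rewrite ler_wpM2l//; lra.
apply: (@le_trans _ _ (3 * (q + e) * (K * (q + e)))); last by lra.
by rewrite ler_pM.
Qed.

Lemma weight_term_le e s w v K : 0 < e -> 0 <= K -> s ^+ 2 <= 4 * w ->
  0 <= v <= K * w -> (s / (w + e)) ^+ 2 * v <= 4 * K.
Proof.
move=> e0 K0 sw /andP[v0 vK]; have w0 : 0 <= w.
  by have := sqr_ge0 s; lra.
have we0 : 0 < w + e by lra.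
rewrite expr_div_n mulrAC ler_pdivrMr ?exprn_gt0//.
apply: (@le_trans _ _ (4 * w * (K * w))); first by rewrite ler_pM// sqr_ge0.
have h3 : 0 <= K * (w * e) by rewrite !mulr_ge0// ltW.
have h4 : 0 <= K * e ^+ 2 by rewrite mulr_ge0// sqr_ge0.
lra.
Qed.

Lemma weight_term'_le e c s w v K : 0 < e -> 0 <= K -> -1 <= c <= 1 ->
  s ^+ 2 <= 4 * w -> 0 <= v <= K * w ->
  `|(c * (w + e) - s ^+ 2 / 2) / (w + e) ^+ 2| * v <= 3 * K.
Proof.
move=> e0 K0 /andP[c1 c2] sw /andP[v0 vK]; have s0 := sqr_ge0 s.
have we0 : 0 < w + e by lra.
rewrite normrM normfV [`|_ ^+ 2|]ger0_norm ?sqr_ge0//.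
rewrite mulrAC ler_pdivrMr ?exprn_gt0//.
have num : `|c * (w + e) - s ^+ 2 / 2| <= 3 * (w + e).
  by rewrite ler_norml; apply/andP; split; nra.
have h1 : v <= K * (w + e).
  by apply: (le_trans vK); rewrite ler_wpM2l//; lra.
apply: (@le_trans _ _ (3 * (w + e) * (K * (w + e)))); last by lra.
by rewrite ler_pM.
Qed.

Lemma sin_sqr_le_weight x j : sin (x ord0 j) ^+ 2 <= 4 * hardy_weight x.
Proof.
have c1 := cos_geN1 (x ord0 j); have c2 := cos_le1 (x ord0 j).
have : (1 - cos (x ord0 j)) / 2 <= hardy_weight x.
  by rewrite /hardy_weight (bigD1 j)//= lerDl sumr_ge0.
rewrite sin2cos2; nra.
Qed.

(** A function controlled by [1 - cos (x_i - x_j)] is thereby controlled by the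
    Hardy weight near the origin. The chord from [x_i] to [x_j] on the unit circle
    is at most the sum of the chords to [1]. *)
Lemma cos_sub_le_weight x i j : i != j ->
  1 - cos (x ord0 i - x ord0 j) <= 4 * hardy_weight x.
Proof.
move=> ij.
have h : (1 - cos (x ord0 i)) / 2 + (1 - cos (x ord0 j)) / 2 <= hardy_weight x.
  rewrite /hardy_weight (bigD1 i)//= lerD2l (bigD1 j)/=; last by rewrite eq_sym.
  by rewrite lerDl sumr_ge0.
apply: (@le_trans _ _ (4 * ((1 - cos (x ord0 i)) / 2 + (1 - cos (x ord0 j)) / 2)));
  last by rewrite ler_pM2l.
have Ei := cos2Dsin2 (x ord0 i); have Ej := cos2Dsin2 (x ord0 j).
rewrite cosB.
have := sqr_ge0 (sin (x ord0 i) + sin (x ord0 j)).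
have := sqr_ge0 (cos (x ord0 i) + cos (x ord0 j) - 2).
lra.
Qed.

(** Uniformity in [e] is what makes the removal of the regularisation a case of
    dominated convergence. *)
Lemma drift_bounded g K : 0 <= K -> exists B, forall e x v, 0 < e ->
  0 <= v -> (forall i j, i != j -> v <= K * (1 - cos (x ord0 i - x ord0 j))) ->
  v <= 4 * K * hardy_weight x ->
  `|\sum_j (- drift' e g j x - drift e g j x ^+ 2)| * v <= B.
Proof.
move=> K0; have K40 : 0 <= 4 * K by rewrite mulr_ge0.
pose N : R := d%:R.
pose b1 := N * (3 * K) / 2 + `|g / 2| * (3 * (4 * K)).
pose b2 := N ^+ 2 * (2 * K) + 2 * (g / 2) ^+ 2 * (4 * (4 * K)).
exists (N * (b1 + b2)) => e x v e0 v0 vK vw.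
apply: (@le_trans _ _ (\sum_j `|- drift' e g j x - drift e g j x ^+ 2| * v)).
  by rewrite -mulr_suml ler_wpM2r// ler_norm_sum.
rewrite /N mulr_natl -[X in _ *+ X]card_ord -sumr_const; apply: ler_sum => j _.
apply: (@le_trans _ _ (`|drift' e g j x| * v + drift e g j x ^+ 2 * v)).
  rewrite -mulrDl ler_wpM2r//; apply: (le_trans (ler_normB _ _)).
  by rewrite normrN lerD2l ger0_norm// sqr_ge0.
have sw := sin_sqr_le_weight x j.
have vw' : 0 <= v <= 4 * K * hardy_weight x by rewrite v0.
have vK' i : i != j -> 0 <= v <= K * (1 - cos (x ord0 j - x ord0 i)).
  by move=> ij; rewrite v0 vK// eq_sym.
apply: lerD.
  rewrite /drift'; apply: (le_trans (ler_wpM2r v0 (ler_normB _ _))).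
  rewrite mulrDl; apply: lerD.
    rewrite normrM (ger0_norm (_ : 0 <= 2^-1))// mulrAC ler_pM2r//.
    have -> : `|\sum_(i | i != j) rcot' e (x ord0 j - x ord0 i)| * v =
        `|\sum_(i | i != j) rcot' e (x ord0 j - x ord0 i) * v|.
      by rewrite -mulr_suml normrM (ger0_norm v0).
    apply: sum_neq_norm_le => [i ij|]; last by rewrite mulr_ge0.
    by rewrite normrM (ger0_norm v0) rcot'_norm_le// vK'.
  rewrite normrM -mulrA ler_wpM2l//.
  by apply: weight_term'_le => //; rewrite cos_geN1 cos_le1.
rewrite /drift; set a := (X in (X / 2 - _) ^+ 2); set b := sin _ / _.
apply: (@le_trans _ _ (a ^+ 2 * v / 2 + 2 * (g / 2) ^+ 2 * (b ^+ 2 * v))).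
  (* the parallelogram identity *)
  have -> : a ^+ 2 * v / 2 + 2 * (g / 2) ^+ 2 * (b ^+ 2 * v) =
    (a / 2 - g / 2 * b) ^+ 2 * v + (a / 2 + g / 2 * b) ^+ 2 * v by field.
  by rewrite lerDl mulr_ge0// sqr_ge0.
apply: lerD; last first.
  apply: ler_wpM2l; first by rewrite mulr_ge0// sqr_ge0.
  exact: weight_term_le.
have sv : v = Num.sqrt v ^+ 2 by rewrite sqr_sqrtr.
have : a ^+ 2 * v <= N ^+ 2 * (2 * K).
  rewrite {1}sv -exprMn /a mulr_suml; apply: sum_neq_sqr_le; last by rewrite mulr_ge0.
  by move=> i ij; rewrite exprMn -sv rcot_sqr_le// vK'.
by have := mulr_ge0 (sqr_ge0 a) v0; lra.
Qed.

End bounds.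

Section convergence.
Context {R : realType} {d : nat}.

Lemma cvg_sumr (T I : Type) (F : set_system T) {FF : Filter F} (r : seq I)
    (P : pred I) (f : I -> T -> R) (a : I -> R) :
  (forall i, P i -> f i t @[t --> F] --> a i) ->
  \sum_(i <- r | P i) f i t @[t --> F] --> \sum_(i <- r | P i) a i.
Proof.
move=> fa; elim: r => [|i r IHr].
  by rewrite big_nil; under eq_fun do rewrite big_nil; exact: cvg_cst.
rewrite big_cons; under eq_fun do rewrite big_cons.
by case: ifPn => // Pi; apply: cvgD => //; exact: fa.
Qed.

Lemma cvg_sqr (T : Type) (F : set_system T) {FF : Filter F} (f : T -> R) (a : R) :
  f t @[t --> F] --> a -> f t ^+ 2 @[t --> F] --> a ^+ 2.
Proof. by move=> fa; under eq_fun do rewrite expr2; rewrite expr2; exact: cvgM. Qed.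

Section at_filter.
Context {T : Type} {F : set_system T} {FF : Filter F}.
Variables (e : T -> R) (e0 : R) (X : T -> 'rV[R]_d) (x : 'rV[R]_d) (g : R).
Hypothesis ee : e t @[t --> F] --> e0.
Hypothesis Xx : forall j, X t ord0 j @[t --> F] --> x ord0 j.

Let cvg_sin (f : T -> R) (a : R) : f t @[t --> F] --> a -> sin (f t) @[t --> F] --> sin a.
Proof. by move=> fa; apply: continuous_cvg fa; exact: continuous_sin. Qed.

Let cvg_cos (f : T -> R) (a : R) : f t @[t --> F] --> a -> cos (f t) @[t --> F] --> cos a.
Proof. by move=> fa; apply: continuous_cvg fa; exact: continuous_cos. Qed.

Let cvg_den (f : T -> R) (a : R) : f t @[t --> F] --> a ->
  1 - cos (f t) + e t @[t --> F] --> 1 - cos a + e0.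
Proof.
by move=> fa; apply: cvgD ee; apply: cvgB; [exact: cvg_cst|exact: cvg_cos].
Qed.

Let cvg_rcot (f : T -> R) (a : R) : f t @[t --> F] --> a -> 1 - cos a + e0 != 0 ->
  rcot (e t) (f t) @[t --> F] --> rcot e0 a.
Proof. by move=> fa a0; apply: cvgM; [exact: cvg_sin|apply: cvgV => //; exact: cvg_den]. Qed.

Let cvg_rcot' (f : T -> R) (a : R) : f t @[t --> F] --> a -> 1 - cos a + e0 != 0 ->
  rcot' (e t) (f t) @[t --> F] --> rcot' e0 a.
Proof.
move=> fa a0; apply: cvgM.
  apply: cvgB; last by apply: cvg_sqr; exact: cvg_sin.
  by apply: cvgM; [exact: cvg_cos|exact: cvg_den].
by apply: cvgV; [by rewrite expf_eq0|by apply: cvg_sqr; exact: cvg_den].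
Qed.

(** Convergence is stated along an arbitrary filter on which both the point and the
    regularisation move: it serves for the continuity of the regularised drift in
    [x] and for the limit [e --> 0] at a fixed point. *)
Lemma cvg_hardy_weight : hardy_weight (X t) @[t --> F] --> hardy_weight x.
Proof.
apply: cvg_sumr => j _; apply: cvgMr_tmp; apply: cvgB; first exact: cvg_cst.
exact: cvg_cos.
Qed.

Lemma cvg_drift j : (forall i, i != j -> 1 - cos (x ord0 j - x ord0 i) + e0 != 0) ->
  hardy_weight x + e0 != 0 ->
  drift (e t) g j (X t) @[t --> F] --> drift e0 g j x.
Proof.
move=> x0 w0; apply: cvgB.
  apply: cvgMr_tmp; apply: cvg_sumr => i ij.
  by apply: cvg_rcot; [exact: cvgB|exact: x0].
apply: cvgMl_tmp; apply: cvgM; first exact: cvg_sin.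
by apply: cvgV => //; apply: cvgD ee; exact: cvg_hardy_weight.
Qed.

Lemma cvg_drift' j : (forall i, i != j -> 1 - cos (x ord0 j - x ord0 i) + e0 != 0) ->
  hardy_weight x + e0 != 0 ->
  drift' (e t) g j (X t) @[t --> F] --> drift' e0 g j x.
Proof.
move=> x0 w0.
have cw : hardy_weight (X t) + e t @[t --> F] --> hardy_weight x + e0.
  by apply: cvgD ee; exact: cvg_hardy_weight.
apply: cvgB.
  apply: cvgMr_tmp; apply: cvg_sumr => i ij.
  by apply: cvg_rcot'; [exact: cvgB|exact: x0].
apply: cvgMl_tmp; apply: cvgM; last first.
  by apply: cvgV; [by rewrite expf_eq0|exact: cvg_sqr].
apply: cvgB; first by apply: cvgM => //; exact: cvg_cos.
by apply: cvgMr_tmp; by apply: cvg_sqr; exact: cvg_sin.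
Qed.

End at_filter.

End convergence.

(** * The cube as a measurable set *)

Section measure_on_cube.
Context {R : realType}.
Local Notation RR := (measurableTypeR R).

Lemma measurable_box n (A : 'I_n -> set RR) : (forall i, measurable (A i)) ->
  measurable [set x : 'rV[RR]_n | forall i, A i (x ord0 i)].
Proof.
move=> mA; rewrite (_ : [set _ | _] = \bigcap_(i in [set: 'I_n])
    (fun x : 'rV[RR]_n => x ord0 i) @^-1` A i).
  apply: fin_bigcap_measurable => // i _; rewrite -[X in measurable X]setTI.
  exact: measurable_coord.
by apply/seteqP; split => x /= Ax i => [_|]; exact: Ax.
Qed.

(** An open set is the countable union of the rational boxes that it contains. *)
Lemma open_measurable_rV n (A : set 'rV[R]_n) : open A ->
  measurable (A : set 'rV[RR]_n).
Proof.
move=> oA.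
pose I (q : 'rV[rat]_n * rat) (i : 'I_n) : set R :=
  `](ratr (q.1 ord0 i) - ratr q.2), (ratr (q.1 ord0 i) + ratr q.2)[%classic.
pose box q : set 'rV[RR]_n := [set x | forall i, I q i (x ord0 i)].
pose B q : set 'rV[RR]_n := if `[< box q `<=` A >] then box q else set0.
have mB q : measurable (B q).
  rewrite /B; case: ifP => // _.
  by apply: (@measurable_box n (I q)) => i; exact: measurable_itv.
have := countable_bigcupT_measurable (countableP _) mB.
rewrite (_ : A = \bigcup_q B q)//; rewrite /B.
apply/seteqP; split => [x Ax|x [q _]]; last by case: asboolP => // + qx; exact.
have /nbhs_ballP[e /= e0 eA] : nbhs x A by exact: open_nbhs_nbhs.
have /rat_in_itvoo[r] : 0 < e / 2 by rewrite divr_gt0.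
rewrite in_itv/= => /andP[r0 re].
have Hp (i : 'I_n) : exists p : rat,
    (`](ratr p - ratr r), (ratr p + ratr r)[%classic : set R) (x ord0 i).
  have /rat_in_itvoo[p] : x ord0 i - ratr r < x ord0 i + ratr r by lra.
  rewrite in_itv/= => /andP[p1 p2]; exists p.
  by rewrite /= in_itv/=; apply/andP; split; lra.
have [p px] := choice Hp.
exists (\row_i p i, r) => //; case: asboolP => [_ i|nb].
  by rewrite /I/= mxE; exact: px.
exfalso; apply: nb => y /= yb; apply: eA; split => // i j; rewrite (ord1 i).
have := px j; have := yb j; rewrite /I /= !in_itv/= mxE /ball/= ltr_norml.
by move=> /andP[? ?] /andP[? ?]; apply/andP; split; lra.
Qed.

Lemma open_cube n : open (@cube R n).
Proof.
rewrite openE => x cx; exists (fun _ j => [set t : R | - pi < t < pi]).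
  move=> i j; rewrite (ord1 i).
  have oI : open (`](- pi), pi[%classic : set R) by exact: interval_open.
  apply: filterS (open_nbhs_nbhs (conj oI _)); first by move=> t /=; rewrite in_itv.
  by rewrite /= in_itv; exact: cx.
by move=> y /= yb j; exact: yb.
Qed.

Lemma measurable_cube n : measurable (@cube R n : set 'rV[RR]_n).
Proof. by apply: open_measurable_rV; exact: open_cube. Qed.

Lemma cube_fin_measure n : (lebesgue_rV R n (@cube R n) < +oo)%E.
Proof.
have mI (i : 'I_n) : measurable (`](- pi), pi[%classic : set RR) by [].
have := lebesgue_rV_box mI; rewrite (_ : [set x | _] = @cube R n); last first.
  apply/seteqP; split => x /= cx i; have := cx i; rewrite /= in_itv//.
move=> ->; pose I : set RR := `](- pi), pi[%classic.
suff : (\prod_(i < n) lebesgue_measure I)%E \is a fin_num by rewrite ltey_eq => ->.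
rewrite /I lebesgue_measure_itv/=; elim/big_ind: _ => // [x y|i _]; first exact: fin_numM.
by case: ifP.
Qed.

Lemma continuous_within_measurable_cube n (f : 'rV[R]_n -> R) :
  {within @cube R n, continuous f} -> measurable_fun (@cube R n : set 'rV[RR]_n) f.
Proof.
move=> /continuousP cf; apply: (measurability _ (measurable_realfun.RGenOpens.measurableE R)).
move=> _ [_ [a [b ->] <-]].
have /open_subspaceP[V oV VD] := cf _ (@interval_open R (BRight a) (BLeft b) isT isT).
rewrite setIC -VD; apply: measurableI; [exact: open_measurable_rV|exact: measurable_cube].
Qed.

End measure_on_cube.

(** * Integration by slices *)

Section integration_on_cube.
Context {R : realType}.
Local Notation RR := (measurableTypeR R).
Local Notation mu := (lebesgue_rV R).
Local Notation nu n := (@lebesgue_measure R \x lebesgue_rV R n)%E.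
Local Notation Ipi := (`](- pi), pi[%classic : set R).

Lemma bounded_integrable_cube n (f : 'rV[RR]_n -> R) (M : R) :
  measurable_fun (@cube R n : set 'rV[RR]_n) f ->
  (forall x, cube x -> `|f x| <= M) -> (mu n).-integrable (@cube R n) (EFin \o f).
Proof.
move=> mf fM; apply: measurable_bounded_integrable => //.
- exact: measurable_cube.
- exact: cube_fin_measure.
- exists M; split => [|N MN x /fM fx]; first exact: num_real.
  exact: le_trans fx (ltW MN).
Qed.

Lemma cube_cons n (p : RR * 'rV[RR]_n) :
  cube (cons_rV p : 'rV[R]_n.+1) <-> (- pi < (p.1 : R) < pi) /\ cube (p.2 : 'rV[R]_n).
Proof.
split=> [cp|[c1 c2] j].
  split=> [|j]; first by have := cp ord0; rewrite cons_rV0.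
  by have := cp (lift ord0 j); rewrite cons_rV_lift.
by have [k ->|->] := unliftP ord0 j; rewrite ?cons_rV0 ?cons_rV_lift//; exact: c2.
Qed.

Lemma set_coord_cons0 n (p : RR * 'rV[RR]_n) (t : R) :
  set_coord (cons_rV p) ord0 t = cons_rV (t : RR, p.2).
Proof.
apply/rowP => j; rewrite mxE; have [k ->|->] := unliftP ord0 j.
  by rewrite eq_sym (negbTE (neq_lift _ _)) !cons_rV_lift.
by rewrite eqxx cons_rV0.
Qed.

Lemma set_coord_cons_lift n (p : RR * 'rV[RR]_n) i (t : R) :
  set_coord (cons_rV p) (lift ord0 i) t = cons_rV (p.1, set_coord p.2 i t : 'rV[RR]_n).
Proof.
apply/rowP => j; rewrite mxE; have [k ->|->] := unliftP ord0 j.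
  by rewrite (inj_eq (@lift_inj _ ord0)) !cons_rV_lift mxE.
by rewrite (negbTE (neq_lift _ _)) !cons_rV0.
Qed.

(** Integrating the slices in the direction [j] suffices to see that an integral
    over the cube vanishes: Fubini's theorem peels off the coordinates before
    [j], which the recursive definition of the measure puts outside. *)
Lemma integral_cube_slices0 n (j : 'I_n) (f : 'rV[R]_n -> R) (M : R) :
  measurable_fun (@cube R n : set 'rV[RR]_n) f ->
  (forall x, cube x -> `|f x| <= M) ->
  (forall x, cube x -> (\int[@lebesgue_measure R]_(t in Ipi)
     (f (set_coord x j t))%:E = 0)%E) ->
  (\int[mu n]_(x in @cube R n) (f x)%:E = 0)%E.
Proof.
elim: n j f => [[]//|n IHn] j f mf fM f0.
pose C : set 'rV[RR]_n.+1 := @cube R n.+1.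
pose F : 'rV[RR]_n.+1 -> \bar R := (EFin \o (f : 'rV[RR]_n.+1 -> R)) \_ C.
pose H : RR * 'rV[RR]_n -> \bar R := F \o @cons_rV R n.
have mF : measurable_fun [set: 'rV[RR]_n.+1] F.
  apply/(measurable_restrictT _ _).1; first exact: measurable_cube.
  exact/measurable_EFinP.
have mH : measurable_fun [set: RR * 'rV[RR]_n] H.
  by apply: measurableT_comp => //; exact: measurable_cons_rV.
have mC : measurable (@cons_rV R n @^-1` C).
  rewrite -[X in measurable X]setTI; apply: measurable_cons_rV => //.
  exact: measurable_cube.
have iH : (nu n).-integrable setT H.
  rewrite (_ : H = (EFin \o (f \o @cons_rV R n)) \_ (@cons_rV R n @^-1` C)); last first.
    by apply/funext => p; rewrite /H /F /patch /=.
  apply/(integrable_mkcond _ mC).1/measurable_bounded_integrable => //.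
  - exact: (@cube_fin_measure R n.+1).
  - apply: (measurable_comp (@measurable_cube R n.+1) _ mf); first by move=> _ [p Cp <-].
    by apply: measurable_funTS; exact: measurable_cons_rV.
  - exists M; split => [|N MN x /fM fx]; first exact: num_real.
    exact: le_trans fx (ltW MN).
have -> : (\int[mu n.+1]_(x in @cube R n.+1) (f x)%:E =
    \int[nu n]_p H p)%E.
  rewrite integral_mkcond -/F.
  by rewrite /= /lebesgue_rVS integral_pushforward//; exact: measurable_cons_rV.
have HE p : H p = if `[< (- pi < (p.1 : R) < pi) /\ cube (p.2 : 'rV[R]_n) >]
    then (f (cons_rV p))%:E else 0%E.
  rewrite /H /F /patch /=; case: asboolP => [/cube_cons cp|ncp].
    by rewrite mem_set.
  by rewrite memNset// => /cube_cons.
have [i jE|jE] := unliftP ord0 j.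
- rewrite -integral12_prod_meas1//; apply: integral0_eq => x _ /=.
  rewrite /fubini_F; under eq_integral do rewrite HE/=.
  have [xpi|nxpi] := pselect (- pi < (x : R) < pi); last first.
    by apply: integral0_eq => y _; case: asboolP => // -[].
  transitivity (\int[mu n]_(y in @cube R n) (f (cons_rV (x, y)))%:E)%E.
    rewrite [RHS]integral_mkcond; apply: eq_integral => y _; rewrite /patch.
    case: asboolP => [[_ /= cy]|ncy]; first by rewrite mem_set.
    by rewrite memNset// => cy; exact: ncy.
  apply: (IHn i) => [|y cy|y cy].
  + apply: (measurable_comp (@measurable_cube R n.+1) _ mf).
      by move=> _ [y cy <-]; apply/cube_cons.
    apply: measurable_funTS; apply: measurableT_comp; first exact: measurable_cons_rV.
    exact: pair1_measurable.
  + by apply: fM; apply/cube_cons.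
  + apply: etrans (f0 (cons_rV (x, y)) _); last exact/cube_cons.
    by apply: eq_integral => t _; rewrite jE set_coord_cons_lift.
- rewrite -integral21_prod_meas1//; apply: integral0_eq => y _ /=.
  rewrite /fubini_G; under eq_integral do rewrite HE/=.
  have [cy|ncy] := pselect (cube (y : 'rV[R]_n)); last first.
    by apply: integral0_eq => x _; case: asboolP => // -[].
  have c0 : cube (cons_rV (0 : RR, y) : 'rV[R]_n.+1).
    by apply/cube_cons; split => //=; rewrite oppr_lt0 pi_gt0.
  apply: etrans (f0 _ c0); rewrite [RHS]integral_mkcond.
  apply: eq_integral => x _; rewrite /patch.
  rewrite jE set_coord_cons0/=; case: asboolP => [[/= xpi _]|nxpi].
    by rewrite mem_set//= in_itv.
  by rewrite memNset//= in_itv/= => xpi; exact: nxpi.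
Qed.

End integration_on_cube.

(** * Slices of functions on the closed cube *)

Section slices.
Context {R : realType} {d : nat}.
Implicit Types (x : 'rV[R]_d) (f : 'rV[R]_d -> R) (j : 'I_d).
Local Notation Jpi := (`[(- pi), pi]%classic : set R).

Lemma cube_ccube x : cube x -> ccube x.
Proof. by move=> cx j; have /andP[? ?] := cx j; rewrite !ltW. Qed.

Lemma ccube_compact : compact (@ccube R d).
Proof.
exact: (@rV_compact R d (fun _ => Jpi) (fun _ => @segment_compact R _ _)).
Qed.

Lemma within_bounded f : {within @ccube R d, continuous f} ->
  exists2 M, 0 <= M & forall x, ccube x -> `|f x| <= M.
Proof.
move=> cf; have := compact_bounded (continuous_compact cf ccube_compact).
move=> [M [Mr fM]]; exists (`|M| + 1) => [|x cx]; first by rewrite addr_ge0.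
by apply: fM; [rewrite ltr_pwDr// ler_norm|exists x].
Qed.

Lemma withinD f g : {within @ccube R d, continuous f} ->
  {within @ccube R d, continuous g} -> {within @ccube R d, continuous (f \+ g)}.
Proof. by move=> cf cg x; apply: cvgD; [exact: cf|exact: cg]. Qed.

Lemma withinM f g : {within @ccube R d, continuous f} ->
  {within @ccube R d, continuous g} -> {within @ccube R d, continuous (f \* g)}.
Proof. by move=> cf cg x; apply: cvgM; [exact: cf|exact: cg]. Qed.

Lemma within_cst (c : R) : {within @ccube R d, continuous (fun=> c)}.
Proof. by move=> x; exact: cvg_cst. Qed.

Lemma within_sum (f : 'I_d -> 'rV[R]_d -> R) :
  (forall j, {within @ccube R d, continuous (f j)}) ->
  {within @ccube R d, continuous (fun x => \sum_j f j x)}.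
Proof. by move=> cf x; apply: cvg_sumr => j _; exact: cf. Qed.

Lemma within_measurable f : {within @ccube R d, continuous f} ->
  measurable_fun (@cube R d : set 'rV[measurableTypeR R]_d) f.
Proof.
move=> cf; apply: continuous_within_measurable_cube.
exact: continuous_subspaceW cube_ccube cf.
Qed.

Lemma within_integrable f : {within @ccube R d, continuous f} ->
  (lebesgue_rV R d).-integrable (@cube R d) (EFin \o f).
Proof.
move=> cf; have [M _ fM] := within_bounded cf.
apply: (@bounded_integrable_cube _ _ _ M); first exact: within_measurable.
by move=> x /cube_ccube; exact: fM.
Qed.

Lemma set_coordE x j t : set_coord x j t = (x - x ord0 j *: dirv R j) + t *: dirv R j.
Proof.
apply/rowP => i; rewrite !mxE eqxx/=.
by have [->|] := eqVneq; rewrite ?mulr1 ?subrK ?mulr0 ?addr0 ?subr0// subrr add0r.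
Qed.

Lemma set_coord_id x j : set_coord x j (x ord0 j) = x.
Proof. by apply/rowP => i; rewrite !mxE; case: eqVneq => // ->. Qed.

Lemma set_coord_continuous x j : continuous (set_coord x j).
Proof.
move=> t; rewrite /continuous_at.
have -> : set_coord x j = fun s => (x - x ord0 j *: dirv R j) + s *: dirv R j.
  by apply/funext => s; exact: set_coordE.
by apply: cvgD; [exact: cvg_cst|apply: cvgZr_tmp; exact: cvg_id].
Qed.

Lemma set_coord_cube x j t : cube x -> - pi < t < pi -> cube (set_coord x j t).
Proof. by move=> cx tpi i; rewrite mxE; case: ifP. Qed.

Lemma set_coord_ccube x j t : ccube x -> - pi <= t <= pi -> ccube (set_coord x j t).
Proof. by move=> cx tpi i; rewrite mxE; case: ifP. Qed.

Lemma within_slice f x j : {within @ccube R d, continuous f} -> ccube x ->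
  {within Jpi, continuous (f \o set_coord x j)}.
Proof.
move=> /subspace_continuousP cf cx; apply/subspace_continuousP => t tpi.
have ct : ccube (set_coord x j t) by apply: set_coord_ccube.
apply: (@cvg_comp _ _ _ _ _ _ (within (@ccube R d) (nbhs (set_coord x j t)))); last exact: cf.
move=> V; rewrite /within/= !nbhs_simpl => nV.
have := @set_coord_continuous x j t _ nV; rewrite /= !nbhs_simpl/= => nV'.
apply: filterS nV' => s /= h spi; apply: h; exact: set_coord_ccube.
Qed.

Lemma is_derive_slice f x j t df : derivable f (set_coord x j t) (dirv R j) ->
  'D_(dirv R j) f (set_coord x j t) = df ->
  is_derive t 1 (f \o set_coord x j) df.
Proof.
have E : (fun h => h^-1 *: (((f \o set_coord x j) \o shift t) (h *: 1) -
             (f \o set_coord x j) t)) =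
   (fun h => h^-1 *: ((f \o shift (set_coord x j t)) (h *: dirv R j)
                                     - f (set_coord x j t))).
  apply/funext => h /=; congr (_ *: (f _ - _)).
  apply/rowP => i; rewrite !mxE eqxx/= [h *: 1]mulr1.
  by case: eqVneq => _; rewrite ?mulr1 ?mulr0 ?add0r.
by move=> fD <-; split; rewrite /derivable /derive E.
Qed.

End slices.

(** The fundamental theorem of calculus on a circle: no boundary term. *)
Lemma integral_derive_periodic (R : realType) (a b : R) (f f' : R -> R) : a < b ->
  {within `[a, b], continuous f} -> {within `[a, b], continuous f'} ->
  (forall t, a < t < b -> is_derive t 1 f (f' t)) -> f a = f b ->
  (\int[@lebesgue_measure R]_(t in `]a, b[) (f' t)%:E = 0)%E.
Proof.
move=> ab cf cf' df fab.
rewrite -(@integral_itv_bndoo _ _ _ _ true false); last first.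
  apply/measurable_EFinP.
  apply: (@measurable_funS _ _ _ _ `[a, b]%classic) => //; first exact: subset_itv_oo_cc.
  exact: subspace_continuous_measurable_fun.
rewrite (@continuous_FTC2 _ f' f)//; first by rewrite fab subee.
  have /(continuous_within_itvP _ ab)[_ fa fb] := cf; split => // t.
  by rewrite in_itv => /df[].
by move=> t; rewrite in_itv => /df tf; rewrite derive1E; exact: derive_val.
Qed.

(** * Antisymmetric periodic functions vanish on the diagonals *)

Section lower_bound_cos.
Context {R : realType}.

(** By the mean value theorem [sin (s / 2)] is [s / 2] times a cosine. Both cosines
    in [sin s = 2 * sin (s / 2) * cos (s / 2)] are then at least [cos (pi / 4)]. *)
Lemma sin_ge_half (s : R) : 0 <= s <= pi / 2 -> s / 2 <= sin s.
Proof.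
move=> /andP[s0 spi].
have [c] := @MVT_segment R sin cos 0 (s / 2) ltac:(lra)
  (fun x _ => is_derive_sin x) (continuous_subspaceT (@continuous_sin R)).
rewrite in_itv/= sin0 !subr0 => /andP[c0 cs] sE.
have c2 (t : R) : 0 <= t <= pi / 4 -> 2 * cos t ^+ 2 >= 1 /\ cos t >= 0.
  move=> /andP[t0 tpi]; have : cos (pi / 2) <= cos (t *+ 2).
    by rewrite leNgt ltr_cos -?leNgt ?in_itv/=; lra.
  rewrite cos_pihalf cos_mulr2n => h; split; first by lra.
  by apply: cos_ge0_pihalf; lra.
have [hc hc0] : 1 <= 2 * cos c ^+ 2 /\ 0 <= cos c by apply: c2; lra.
have [hs hs0] : 1 <= 2 * cos (s / 2) ^+ 2 /\ 0 <= cos (s / 2) by apply: c2; lra.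
have [sh _] := half_angle s; rewrite sh sE.
have : 1 <= 2 * (cos c * cos (s / 2)).
  have [h|/ltW h] := leP (cos c) (cos (s / 2)).
    by have := ler_wpM2l hc0 h; lra.
  by have := ler_wpM2r hs0 h; lra.
by move=> /(ler_wpM2r s0); lra.
Qed.

Lemma one_sub_cos_ge (m : R) : 0 <= m <= pi -> m ^+ 2 / 8 <= 1 - cos m.
Proof.
move=> /andP[m0 mpi]; have [_ ->] := half_angle m.
have := @sin_ge_half (m / 2) ltac:(lra); nra.
Qed.

End lower_bound_cos.

Section C1_periodic.
Context {R : realType} {d : nat}.
Implicit Types (x : 'rV[R]_d) (u : 'rV[R]_d -> R) (g F D : 'I_d -> 'rV[R]_d -> R).

(** First-order regularity up to the boundary of the cube. The function [g j] is
    the continuous extension to the closed cube of the [j]-th partial derivative. *)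
Record C1_periodic u g : Prop := {
  C1_continuous : {within @ccube R d, continuous u};
  C1_grad_continuous : forall j, {within @ccube R d, continuous (g j)};
  C1_derivable : forall x j, cube x -> derivable u x (dirv R j);
  C1_gradE : forall x j, cube x -> 'D_(dirv R j) u x = g j x;
  C1_per : forall x j, ccube x -> u (set_coord x j (- pi)) = u (set_coord x j pi) }.

Section fixed.
Variables (u : 'rV[R]_d -> R) (g : 'I_d -> 'rV[R]_d -> R).
Hypothesis ug : C1_periodic u g.

Lemma C1_is_derive x j t : cube x -> - pi < t < pi ->
  is_derive t 1 (u \o set_coord x j) (g j (set_coord x j t)).
Proof.
move=> cx tpi; have ct := set_coord_cube j cx tpi.
apply: is_derive_slice; [exact: (C1_derivable ug)|exact: (C1_gradE ug)].
Qed.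

Lemma C1_lipschitz x j (M a b : R) :
  (forall x, ccube x -> `|g j x| <= M) -> cube x ->
  - pi <= a <= pi -> - pi <= b <= pi ->
  `|u (set_coord x j a) - u (set_coord x j b)| <= M * `|a - b|.
Proof.
move=> gM cx; wlog ab : a b / b <= a => [H apos bpos|].
  have [/H|/ltW/H] := leP b a; first exact.
  by rewrite distrC [X in _ * X]distrC; exact.
move=> /andP[a1 a2] /andP[b1 b2].
have cu : {within `[b, a], continuous (u \o set_coord x j)}.
  apply: continuous_subspaceW _ (within_slice (C1_continuous ug) (cube_ccube cx)).
  by move=> t /=; rewrite !in_itv/= => /andP[? ?]; apply/andP; split; lra.
have du t : t \in `]b, a[%R ->
    is_derive t 1 (u \o set_coord x j) (g j (set_coord x j t)).
  by rewrite in_itv/= => /andP[? ?]; apply: C1_is_derive => //; apply/andP; split; lra.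
have [c] := MVT_segment ab du cu.
rewrite in_itv/= => /andP[c1 c2] /= ->; rewrite normrM ler_wpM2r//.
by apply: gM; apply: set_coord_ccube; [exact: cube_ccube|apply/andP; split; lra].
Qed.

(** By antisymmetry [u] vanishes where [x_i = x_j]. Moving only the coordinate
    [x_i] to [x_j], directly or by periodicity around the circle, bounds [u] by
    a Lipschitz constant times the distance of [x_i] to [x_j] modulo [2 * pi],
    whose square is at most [8 * (1 - cos (x_i - x_j))]. *)
Lemma C1_antisym_vanish :
  (forall (i j : 'I_d) x, i != j -> ccube x -> u (xcol i j x) = - u x) ->
  exists2 K, 0 <= K & forall x i j, cube x -> i != j ->
    u x ^+ 2 <= K * (1 - cos (x ord0 i - x ord0 j)).
Proof.
move=> anti.
have [B B0 gB] := within_bounded (within_sum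
  (fun j => withinM (C1_grad_continuous ug (j := j)) (C1_grad_continuous ug (j := j)))).
(* [B] bounds the sum of the squares, hence [B + 1] each partial derivative *)
pose M := B + 1.
have gM j x : ccube x -> `|g j x| <= M.
  move=> cx; have : g j x ^+ 2 <= B.
    apply: le_trans (gB _ cx); apply: le_trans (ler_norm _).
    by rewrite (bigD1 j)//= lerDl sumr_ge0// => i _; rewrite -expr2 sqr_ge0.
  by move=> h; rewrite /M ler_norml; apply/andP; split; nra.
exists (8 * M ^+ 2) => [|x i j cx ij]; first by rewrite mulr_ge0// sqr_ge0.
have M0 : 0 <= M by rewrite addr_ge0.
have pi0 := @pi_gt0 R.
have /andP[xi1 xi2] := cx i; have /andP[xj1 xj2] := cx j.
have u0 : u (set_coord x i (x ord0 j)) = 0.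
  set y := set_coord x i _.
  have cy : ccube y.
    by apply: set_coord_ccube; [exact: cube_ccube|apply/andP; split; lra].
  have := anti _ _ _ ij cy; rewrite (_ : xcol i j y = y); first by lra.
  apply/rowP => k; rewrite !mxE /=.
  by case: perm.tpermP => [->|->|//]; rewrite !eqxx [j == i]eq_sym (negbTE ij).
have lip a b : - pi <= a <= pi -> - pi <= b <= pi ->
    `|u (set_coord x i a) - u (set_coord x i b)| <= M * `|a - b|.
  by apply: C1_lipschitz => //; exact: gM.
have per := C1_per ug i (cube_ccube cx).
have direct : `|u x| <= M * `|x ord0 i - x ord0 j|.
  rewrite -{1}(set_coord_id x i) -[u _]subr0 -u0.
  by apply: lip; apply/andP; split; lra.
have around : `|u x| <= M * (2 * pi - `|x ord0 i - x ord0 j|).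
  have ppi : - pi <= (pi : R) <= pi by apply/andP; split; lra.
  have npi : - pi <= (- pi : R) <= pi by apply/andP; split; lra.
  have E1 := lip _ _ (cube_ccube cx i) ppi; have E2 := lip _ _ npi (cube_ccube cx j).
  have E3 := lip _ _ (cube_ccube cx i) npi; have E4 := lip _ _ ppi (cube_ccube cx j).
  rewrite set_coord_id in E1 E3; rewrite u0 subr0 in E2; rewrite u0 subr0 in E4.
  have [ge|/ltW le] := leP (x ord0 j) (x ord0 i).
    have -> : u x = (u x - u (set_coord x i pi)) + u (set_coord x i (- pi)).
      by rewrite per; ring.
    apply: (le_trans (ler_normD _ _)).
    rewrite [`|x ord0 i - x ord0 j|]ger0_norm ?subr_ge0//.
    have e1 : `|x ord0 i - pi| = pi - x ord0 i by rewrite ler0_norm ?opprB// subr_le0 ltW.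
    have e2 : `|- pi - x ord0 j| = pi + x ord0 j.
      by rewrite -normrN opprB opprK addrC ger0_norm//; lra.
    rewrite {}e1 in E1; rewrite {}e2 in E2.
    lra.
  have -> : u x = (u x - u (set_coord x i (- pi))) + u (set_coord x i pi).
    by rewrite per; ring.
  apply: (le_trans (ler_normD _ _)).
  rewrite [`|x ord0 i - x ord0 j|]ler0_norm ?subr_le0//.
  have e3 : `|x ord0 i - - pi| = x ord0 i + pi by rewrite opprK ger0_norm//; lra.
  have e4 : `|pi - x ord0 j| = pi - x ord0 j by rewrite ger0_norm// subr_ge0 ltW.
  rewrite {}e3 in E3; rewrite {}e4 in E4.
  lra.
have cabs : cos (x ord0 i - x ord0 j) = cos `|x ord0 i - x ord0 j|.
  by case: ger0P => // _; rewrite cosN.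
have d0 := normr_ge0 (x ord0 i - x ord0 j).
have d2 : `|x ord0 i - x ord0 j| <= 2 * pi.
  by rewrite ler_norml; apply/andP; split; lra.
rewrite cabs; move: `|x ord0 i - x ord0 j| d0 d2 direct around => t t0 t2 dir aro.
rewrite -[u x ^+ 2]ger0_norm ?sqr_ge0// normrX.
have [tpi|/ltW tpi] := leP t pi.
  have := @one_sub_cos_ge R t ltac:(lra).
  have : `|u x| ^+ 2 <= (M * t) ^+ 2 by rewrite lerXn2r ?nnegrE// mulr_ge0.
  by have := sqr_ge0 M; nra.
have := @one_sub_cos_ge R (2 * pi - t) ltac:(lra).
have -> : cos (2 * pi - t) = cos t.
  by rewrite cosB mulrDl mul1r -mulr2n cos2pi sin2pi; ring.
have : `|u x| ^+ 2 <= (M * (2 * pi - t)) ^+ 2.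
  by rewrite lerXn2r ?nnegrE// mulr_ge0//; lra.
by have := sqr_ge0 M; nra.
Qed.

End fixed.
End C1_periodic.

(** * Ground-state substitution *)

Section supersolution.
Context {R : realType} {d : nat}.
Implicit Types (x : 'rV[R]_d) (u : 'rV[R]_d -> R) (g F D : 'I_d -> 'rV[R]_d -> R).
Local Notation mu := (lebesgue_rV R d).
Local Notation Q := (@cube R d).

Lemma Rintegral_sum (f : 'I_d -> 'rV[R]_d -> R) :
  (forall j, mu.-integrable Q (EFin \o f j)) ->
  \int[mu]_(x in Q) (\sum_j f j x) = \sum_j \int[mu]_(x in Q) f j x.
Proof.
move=> If; rewrite /Rintegral.
under eq_integral do rewrite -sumEFin.
rewrite integral_sum//; last exact: measurable_cube.
rewrite sum_fine// => j _; apply: integrable_fin_num; last exact: If.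
exact: measurable_cube.
Qed.

Lemma integral_div_zero u g (F D : 'I_d -> 'rV[R]_d -> R) j : C1_periodic u g ->
  {within @ccube R d, continuous (F j)} -> {within @ccube R d, continuous (D j)} ->
  (forall x, cube x -> F j (set_coord x j (- pi)) = F j (set_coord x j pi)) ->
  (forall x t, cube x -> - pi < t < pi ->
    is_derive t 1 (F j \o set_coord x j) (D j (set_coord x j t))) ->
  \int[mu]_(x in Q) (D j x * u x ^+ 2 + F j x * (2 * u x * g j x)) = 0.
Proof.
move=> ug cF cD pF dF; have cu := C1_continuous ug; have cg := C1_grad_continuous ug (j := j).
have cG : {within @ccube R d, continuous (fun x => D j x * u x ^+ 2 + F j x * (2 * u x * g j x))}.
  apply: withinD; apply: withinM => //; first exact: withinM.
  by apply: withinM => //; apply: withinM => //; exact: within_cst.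
have [M _ GM] := within_bounded cG.
rewrite /Rintegral (@integral_cube_slices0 _ _ j _ M)//.
- exact: within_measurable.
- by move=> x /cube_ccube; exact: GM.
move=> x cx; have ccx := cube_ccube cx.
have pi2 : - pi < pi :> R by have := @pi_gt0 R; lra.
apply: (@integral_derive_periodic _ _ _
  (fun t => F j (set_coord x j t) * u (set_coord x j t) ^+ 2)) => //.
- exact: (within_slice (withinM cF (withinM cu cu)) ccx).
- exact: (within_slice cG ccx).
- move=> t tpi; have dFt := dF _ _ cx tpi; have dut := C1_is_derive ug j cx tpi.
  have H := is_deriveM dFt (is_deriveM dut dut).
  set y := set_coord x j t in H *.
  have E : F j y * (u y * g j y + u y * g j y) + (u y * u y) * D j y =
    D j y * u y ^+ 2 + F j y * (2 * u y * g j y) by ring.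
  rewrite -E; exact: H.
- by rewrite pF// (C1_per ug).
Qed.

(** If [F] were the logarithmic gradient of a positive supersolution [phi], the
    left-hand potential would be [- Laplacian phi / phi]; for a general [F],
    expand the square in [0 <= |grad u - u F| ^+ 2] and use the divergence theorem. *)
Lemma supersolution_ineq u g F D : C1_periodic u g ->
  (forall j, {within @ccube R d, continuous (F j)}) ->
  (forall j, {within @ccube R d, continuous (D j)}) ->
  (forall j x, cube x -> F j (set_coord x j (- pi)) = F j (set_coord x j pi)) ->
  (forall j x t, cube x -> - pi < t < pi ->
    is_derive t 1 (F j \o set_coord x j) (D j (set_coord x j t))) ->
  \int[mu]_(x in Q) ((\sum_j (- D j x - F j x ^+ 2)) * u x ^+ 2) <=
  \int[mu]_(x in Q) (\sum_j g j x ^+ 2).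
Proof.
move=> ug cF cD pF dF; have cu := C1_continuous ug; have cg := C1_grad_continuous ug.
have cu2 : {within @ccube R d, continuous (fun x => u x ^+ 2)} by exact: withinM.
have cg2 : {within @ccube R d, continuous (fun x => \sum_j g j x ^+ 2)}.
  by apply: within_sum => j; exact: withinM.
pose G j x := D j x * u x ^+ 2 + F j x * (2 * u x * g j x).
have cG j : {within @ccube R d, continuous (G j)}.
  apply: withinD; apply: withinM => //.
  by apply: withinM => //; apply: withinM => //; exact: within_cst.
have cP : {within @ccube R d, continuous (fun x => (\sum_j (- D j x - F j x ^+ 2)) * u x ^+ 2)}.
  apply: withinM => //; apply: within_sum => j x; apply: cvgB; first exact: cvgN (cD j x).
  exact: (withinM (cF j) (cF j)).
have G0 : \int[mu]_(x in Q) (\sum_j G j x) = 0.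
  rewrite Rintegral_sum => [|j]; last exact: within_integrable.
  by apply: big1 => j _; exact: (integral_div_zero ug (cF j) (cD j) (pF j) (dF j)).
rewrite -[leRHS]subr0 -[X in _ <= _ - X]G0 -RintegralB; last 3 first.
- exact: measurable_cube.
- by apply: within_integrable; exact: cg2.
- by apply: within_integrable; exact: within_sum.
apply: le_Rintegral => [|||x _].
- exact: measurable_cube.
- by apply: within_integrable; exact: cP.
- apply: within_integrable => x; apply: cvgB; first exact: cg2.
  exact: (within_sum cG).
rewrite mulr_suml -sumrB; apply: ler_sum => j _; rewrite /G -subr_ge0.
have -> : g j x ^+ 2 - (D j x * u x ^+ 2 + F j x * (2 * u x * g j x))
   - (- D j x - F j x ^+ 2) * u x ^+ 2 = (g j x - F j x * u x) ^+ 2 by ring.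
exact: sqr_ge0.
Qed.

End supersolution.

(** * Regularity of the regularised drift *)

Section drift_regularity.
Context {R : realType} {d : nat}.
Implicit Types (x : 'rV[R]_d) (e g t : R) (i j : 'I_d).

Lemma is_derive_const (c t : R) : is_derive t 1 (fun=> c : R) 0.
Proof. exact: is_derive_cst. Qed.

Lemma is_derive_div (f h : R -> R) t df dh : h t != 0 ->
  is_derive t 1 f df -> is_derive t 1 h dh ->
  is_derive t 1 (fun s => f s / h s) ((df * h t - f t * dh) / h t ^+ 2).
Proof.
move=> h0 fd hd; have H := is_deriveM fd (is_deriveV h0 hd).
have -> : (df * h t - f t * dh) / h t ^+ 2 =
    f t * (- (h t) ^- 2 * dh) + (h t)^-1 * df by field.
exact: H.
Qed.

Lemma is_derive_sumr (r : seq 'I_d) (P : pred 'I_d) (f : 'I_d -> R -> R) (df : 'I_d -> R) t :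
  (forall i, P i -> is_derive t 1 (f i) (df i)) ->
  is_derive t 1 (fun s => \sum_(i <- r | P i) f i s) (\sum_(i <- r | P i) df i).
Proof.
move=> fd; elim: r => [|i r IHr].
  rewrite big_nil; under eq_fun do rewrite big_nil; exact: is_derive_cst.
rewrite big_cons; under eq_fun do rewrite big_cons.
by case: ifPn => // Pi; exact: is_deriveD (fd _ Pi) IHr.
Qed.

Lemma rcot_den_gt0 e t : 0 < e -> 0 < 1 - cos t + e.
Proof. by move=> e0; have := cos_le1 t; lra. Qed.

Lemma is_derive_rcot (e a t : R) : 0 < e ->
  is_derive t 1 (fun s => rcot e (s - a)) (rcot' e (t - a)).
Proof.
move=> e0; have ida : is_derive t 1 (fun s => s - a) (1 : R).
  have H := is_deriveB (is_derive_id t 1) (is_derive_const a t).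
  by rewrite subr0 in H.
have sd := @is_derive1_comp R sin (fun s => s - a) t _ _ (is_derive_sin (t - a)) ida.
have cd := @is_derive1_comp R cos (fun s => s - a) t _ _ (is_derive_cos (t - a)) ida.
have dd : is_derive t 1 (fun s => 1 - cos (s - a) + e) (sin (t - a)).
  have H := is_deriveD (is_deriveB (is_derive_const 1 t) cd) (is_derive_const e t).
  by rewrite mulr1 addr0 sub0r opprK in H.
have := @is_derive_div (fun s => sin (s - a)) (fun s => 1 - cos (s - a) + e) t _ _
  (lt0r_neq0 (rcot_den_gt0 (t - a) e0)) sd dd.
by rewrite mulr1 /rcot' expr2.
Qed.

Lemma rcotD2pi e t : rcot e (t + pi *+ 2) = rcot e t.
Proof. by rewrite /rcot sinD2pi cosD2pi. Qed.

Lemma hardy_weight_set_coord x j t :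
  hardy_weight (set_coord x j t) = \sum_(i | i != j) (1 - cos (x ord0 i)) / 2 + (1 - cos t) / 2.
Proof.
rewrite /hardy_weight (bigD1 j)//= mxE eqxx addrC; congr (_ + _).
by apply: eq_bigr => i ij; rewrite mxE (negbTE ij).
Qed.

Lemma drift_set_coord e g j x t : drift e g j (set_coord x j t) =
  (\sum_(i | i != j) rcot e (t - x ord0 i)) / 2
  - g / 2 * (sin t / (\sum_(i | i != j) (1 - cos (x ord0 i)) / 2 + (1 - cos t) / 2 + e)).
Proof.
rewrite /drift hardy_weight_set_coord mxE eqxx; congr (_ / _ - _).
by apply: eq_bigr => i ij; rewrite mxE (negbTE ij).
Qed.

Lemma drift'_set_coord e g j x t : drift' e g j (set_coord x j t) =
  (\sum_(i | i != j) rcot' e (t - x ord0 i)) / 2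
  - g / 2 * ((cos t * (\sum_(i | i != j) (1 - cos (x ord0 i)) / 2 + (1 - cos t) / 2 + e)
              - sin t ^+ 2 / 2)
     / (\sum_(i | i != j) (1 - cos (x ord0 i)) / 2 + (1 - cos t) / 2 + e) ^+ 2).
Proof.
rewrite /drift' hardy_weight_set_coord mxE eqxx; congr (_ / _ - _).
by apply: eq_bigr => i ij; rewrite mxE (negbTE ij).
Qed.

Lemma drift_periodic e g j x :
  drift e g j (set_coord x j (- pi)) = drift e g j (set_coord x j pi).
Proof.
rewrite !drift_set_coord cosN sinN sinpi oppr0 !mul0r.
congr (_ / _ - _); apply: eq_bigr => i _.
by rewrite -rcotD2pi; congr rcot; ring.
Qed.

Lemma drift_is_derive e g j x t : 0 < e ->
  is_derive t 1 (drift e g j \o set_coord x j) (drift' e g j (set_coord x j t)).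
Proof.
move=> e0; rewrite drift'_set_coord.
rewrite (_ : _ \o _ = fun s => (\sum_(i | i != j) rcot e (s - x ord0 i)) / 2
  - g / 2 * (sin s /
      (\sum_(i | i != j) (1 - cos (x ord0 i)) / 2 + (1 - cos s) / 2 + e))); last first.
  by apply/funext => s /=; rewrite drift_set_coord.
set W := \sum_(i | i != j) _.
have W0 : 0 <= W.
  by apply: sumr_ge0 => i _; have := cos_le1 (x ord0 i); lra.
have dn0 : W + (1 - cos t) / 2 + e != 0.
  by apply: lt0r_neq0; have := cos_le1 t; lra.
have dd : is_derive t 1 (fun s => W + (1 - cos s) / 2 + e) (sin t / 2).
  have H := is_deriveD (is_deriveD (is_derive_const W t)
    (is_deriveM (is_deriveB (is_derive_const 1 t) (is_derive_cos t)) (is_derive_const (2^-1) t)))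
     (is_derive_const e t).
  apply: is_derive_eq H _.
  by rewrite /GRing.scale/=; field.
have sd := is_derive_sumr (index_enum _) (fun i (_ : i != j) => is_derive_rcot (x ord0 i) t e0).
have H := is_deriveB (is_deriveM sd (is_derive_const (2^-1) t))
  (is_deriveM (is_derive_const (g / 2) t)
    (@is_derive_div sin (fun s => W + (1 - cos s) / 2 + e) t _ _ dn0 (is_derive_sin t) dd)).
apply: is_derive_eq H _.
rewrite /GRing.scale/= !mulr0 add0r addr0 mulrC; congr (_ - _ * (_ / _)).
by ring.
Qed.

Lemma drift_regularized_den e x : 0 < e ->
  (forall i j, i != j -> 1 - cos (x ord0 j - x ord0 i) + e != 0) /\
  hardy_weight x + e != 0.
Proof.
move=> e0; split=> [i j _|]; first exact/lt0r_neq0/rcot_den_gt0.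
by apply: lt0r_neq0; have := hardy_weight_ge0 x; lra.
Qed.

Lemma within_coord k : {within @ccube R d, continuous (fun x => x ord0 k)}.
Proof. by apply: continuous_subspaceT; exact: coord_continuous. Qed.

Lemma within_drift e g j : 0 < e -> {within @ccube R d, continuous (drift e g j)}.
Proof.
move=> e0 x; have [h1 h2] := drift_regularized_den x e0.
apply: (@cvg_drift _ _ _ _ _ (fun=> e) e id x g) => //; first exact: cvg_cst.
- move=> k; exact: within_coord.
- by move=> i; exact: h1.
Qed.

Lemma within_drift' e g j : 0 < e -> {within @ccube R d, continuous (drift' e g j)}.
Proof.
move=> e0 x; have [h1 h2] := drift_regularized_den x e0.
apply: (@cvg_drift' _ _ _ _ _ (fun=> e) e id x g) => //; first exact: cvg_cst.
- move=> k; exact: within_coord.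
- by move=> i; exact: h1.
Qed.

Lemma within_hardy_weight : {within @ccube R d, continuous (@hardy_weight R d)}.
Proof.
move=> x; apply: (@cvg_hardy_weight _ _ _ _ _ id x) => k.
exact: within_coord.
Qed.

End drift_regularity.

(** * The Hardy inequality with a shift for real functions *)

Section hardy_real.
Context {R : realType} {d : nat}.
Implicit Types (x : 'rV[R]_d) (e : R).
Local Notation mu := (lebesgue_rV R d).
Local Notation Q := (@cube R d).
Variables (u : 'rV[R]_d -> R) (g : 'I_d -> 'rV[R]_d -> R).
Hypothesis d2 : (2 <= d)%N.
Hypothesis ug : C1_periodic u g.
Hypothesis anti : forall (i j : 'I_d) x, i != j -> ccube x -> u (xcol i j x) = - u x.

(** The bound that dominates the limit [e --> 0]. The second part uses two
    distinct indices, hence [2 <= d]. *)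
Lemma antisym_weight_bound : exists2 K, 0 <= K & forall x, cube x ->
  (forall i j, i != j -> u x ^+ 2 <= K * (1 - cos (x ord0 i - x ord0 j))) /\
  u x ^+ 2 <= 4 * K * hardy_weight x.
Proof.
have [K K0 uK] := C1_antisym_vanish ug anti; exists K => // x cx.
split=> [i j ij|]; first exact: uK.
pose i0 : 'I_d := Ordinal (ltnW d2); pose i1 : 'I_d := Ordinal d2.
apply: le_trans (uK x i0 i1 cx isT) _; rewrite [4 * K]mulrC -mulrA ler_wpM2l//.
exact: cos_sub_le_weight.
Qed.

Lemma antisym_support x : cube x -> u x != 0 ->
  (forall i j, i != j -> cos (x ord0 i - x ord0 j) != 1) /\
  hardy_weight x != 0.
Proof.
move=> cx u0; have [K K0 /(_ x cx)[uK uw]] := antisym_weight_bound.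
have u2 : 0 < u x ^+ 2 by rewrite lt_def sqrf_eq0 u0 sqr_ge0.
split=> [i j /uK|]; last by apply: contraTneq uw => ->; rewrite mulr0 -ltNge.
by apply: contraTneq => ->; rewrite subrr mulr0 -ltNge.
Qed.

(** This is [- Laplacian phi / phi] away from the zeros of [phi] and the origin. *)
Definition cot_potential (a : R) x : R :=
  \sum_j (- drift' 0 a j x - drift 0 a j x ^+ 2).

Let cu2 : {within @ccube R d, continuous (fun x => u x ^+ 2)}.
Proof. exact: withinM (C1_continuous ug) (C1_continuous ug). Qed.

(** The regularisation is removed at every point of the cube, not merely almost
    everywhere: on the singular set of the drift [u] vanishes, and the integrand
    is constantly zero. *)
Lemma cot_potential_ineq a :
  mu.-integrable Q (EFin \o (fun x => cot_potential a x * u x ^+ 2)) /\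
  \int[mu]_(x in Q) (cot_potential a x * u x ^+ 2) <=
  \int[mu]_(x in Q) (\sum_j g j x ^+ 2).
Proof.
pose pot e x := (\sum_j (- drift' e a j x - drift e a j x ^+ 2)) * u x ^+ 2.
pose en n : R := harmonic n.
have en0 n : 0 < en n by rewrite /en/= invr_gt0 ltr0n.
have [K K0 uK] := antisym_weight_bound.
have [B potB] := @drift_bounded R d a K K0.
have cpot n : {within @ccube R d, continuous (pot (en n))}.
  apply: withinM cu2; apply: within_sum => j x; apply: cvgB.
    apply: cvgN; exact: within_drift'.
  by apply: cvg_sqr; exact: within_drift.
have lim x : cube x -> pot (en n) x @[n --> \oo] --> cot_potential a x * u x ^+ 2.
  move=> cx; have [u0|u0] := eqVneq (u x) 0.
    by rewrite /pot u0 expr0n mulr0; under eq_fun do rewrite mulr0; exact: cvg_cst.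
  have [c1 w0] := antisym_support cx u0.
  apply: cvgMr_tmp; apply: cvg_sumr => j _.
  have c0 i : i != j -> 1 - cos (x ord0 j - x ord0 i) + 0 != 0.
    by move=> ij; rewrite addr0 subr_eq0 eq_sym c1// eq_sym.
  have w0' : hardy_weight x + 0 != 0 by rewrite addr0.
  apply: cvgB; first apply: cvgN.
    apply: (@cvg_drift' _ _ _ _ _ en 0 (fun=> x) x) => //; first exact: cvg_harmonic.
    by move=> k; exact: cvg_cst.
  apply: cvg_sqr; apply: (@cvg_drift _ _ _ _ _ en 0 (fun=> x) x) => //.
    exact: cvg_harmonic.
  by move=> k; exact: cvg_cst.
have bnd n x : cube x -> `|pot (en n) x| <= B.
  move=> cx; rewrite /pot normrM [`|u x ^+ 2|]ger0_norm ?sqr_ge0//.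
  by have [uc uw] := uK x cx; apply: potB => //; exact: sqr_ge0.
have elim x : Q x -> (pot (en n) x)%:E @[n --> \oo] --> (cot_potential a x * u x ^+ 2)%:E.
  by move=> cx; apply: cvg_EFin; [exact: nearW|exact: lim].
have mpot n : measurable_fun (Q : set 'rV[measurableTypeR R]_d) (EFin \o pot (en n)).
  by apply/measurable_EFinP; exact: within_measurable.
have [||||I _ L] := @dominated_convergence _ _ R mu Q (@measurable_cube R d)
  (fun n => EFin \o pot (en n)) (EFin \o (fun x => cot_potential a x * u x ^+ 2))
  (EFin \o (fun=> B)) mpot _ _ _ _.
- exact: emeasurable_fun_cvg mpot elim.
- exact: aeW.
- by apply: within_integrable; exact: within_cst.
- by apply: aeW => x n cx; rewrite /= lee_fin; exact: bnd.
split=> //.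
rewrite -(fineK (integrable_fin_num (@measurable_cube R d) I)) in L.
apply: (cvgr_to_le (fine_cvg L)); apply: nearW => n /=.
apply: (supersolution_ineq (F := drift (en n) a) (D := drift' (en n) a) ug)
  => [j|j|j x _|j x t _ _].
- exact: within_drift.
- exact: within_drift'.
- exact: drift_periodic.
- exact: drift_is_derive.
Qed.

(** The quotient is bounded on the cube, although both terms vanish at the origin. *)
Lemma integrable_hardy : mu.-integrable Q (EFin \o (fun x => u x ^+ 2 / hardy_weight x)).
Proof.
have [K K0 uK] := antisym_weight_bound.
apply: (@bounded_integrable_cube _ _ _ (4 * K)); last first.
  move=> x cx; have [_ uw] := uK x cx.
  have w0 := hardy_weight_ge0 x; have v0 := sqr_ge0 (u x).
  rewrite ger0_norm; last by rewrite divr_ge0.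
  have [->|wn0] := eqVneq (hardy_weight x) 0; first by rewrite invr0 mulr0 mulr_ge0.
  by rewrite ler_pdivrMr// lt_def wn0.
apply: (@measurable_fun_cvg _ _ _ _ (fun n x => u x ^+ 2 / (hardy_weight x + harmonic n))).
  move=> n; apply: within_measurable.
  apply: (withinM cu2 (g := fun x => (hardy_weight x + harmonic n)^-1)) => x.
  apply: cvgV.
    by apply: lt0r_neq0; rewrite ltr_wpDl ?hardy_weight_ge0//= invr_gt0 ltr0n.
  by apply: cvgD; [exact: within_hardy_weight|exact: cvg_cst].
move=> x cx; have [u0|u0] := eqVneq (u x) 0.
  by rewrite u0 expr0n mul0r; under eq_fun do rewrite mul0r; exact: cvg_cst.
have [_ w0] := antisym_support cx u0.
apply: cvgMl_tmp; apply: cvgV => //; rewrite -[X in _ --> X]addr0.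
by apply: cvgD; [exact: cvg_cst|exact: cvg_harmonic].
Qed.

Let N : R := d%:R.

(** The ground-state inequality for [phi], with the term in [\sum_j sin (x_j / 2) ^+ 4]
    bounded below by Cauchy--Schwarz. The coefficient of the Hardy term is largest
    for [a = (d ^+ 2 - 2) / 4]; [a = 0] is a spectral gap. *)
Lemma hardy_shifted a : 0 <= a ->
  a * (N ^+ 2 / 2 - 1 - a) * (\int[mu]_(x in Q) (u x ^+ 2 / hardy_weight x)) +
  (N * (N ^+ 2 - 1) / 12 - a * N + a * (a + 1) / N) * (\int[mu]_(x in Q) u x ^+ 2)
  <= \int[mu]_(x in Q) (\sum_j g j x ^+ 2).
Proof.
move=> a0; have [ipot] := cot_potential_ineq a; apply: le_trans.
have iu2 : mu.-integrable Q (EFin \o (fun x => u x ^+ 2)) by exact: within_integrable.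
set c2 := _ - a * N + _; set c1 := a * (_ - a).
have mQ := @measurable_cube R d.
rewrite -!RintegralZl//; last exact: integrable_hardy.
have i1 : mu.-integrable Q (EFin \o (fun x => c1 * (u x ^+ 2 / hardy_weight x))).
  exact: (integrableZl mQ c1 integrable_hardy).
have i2 : mu.-integrable Q (EFin \o (fun x => c2 * u x ^+ 2)).
  exact: (integrableZl mQ c2 iu2).
rewrite -RintegralD//; apply: le_Rintegral => //.
  exact: (integrableD mQ i1 i2).
move=> x cx; have [->|u0] := eqVneq (u x) 0; first by rewrite expr0n/= !(mul0r, mulr0) addr0.
have [c w0] := antisym_support cx u0.
rewrite /cot_potential potentialE// -/N.
set s := \sum_j _; set w := hardy_weight x in w0 *.
have N0 : 0 < N by rewrite ltr0n (ltn_trans _ d2).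
have ws : w ^+ 2 <= N * s by exact: sum_sqr_ge.
have sN : N^-1 <= s / w ^+ 2.
  by rewrite ler_pdivlMr ?exprn_even_gt0// mulrC ler_pdivrMr// mulrC.
have -> : c1 * (u x ^+ 2 / w) + c2 * u x ^+ 2 = (c1 / w + c2) * u x ^+ 2 by ring.
rewrite ler_wpM2r ?sqr_ge0//.
have : a * (a + 1) * N^-1 <= a * (a + 1) * (s / w ^+ 2).
  by rewrite ler_wpM2l// mulr_ge0// addr_ge0.
rewrite /c2 /c1; lra.
Qed.

End hardy_real.

(** * Constants and complex-valued functions *)

Section constants.
Context {R : realType}.

(** The upper bound is an equality for even [d]. *)
Lemma C_P_as_bounds (d : nat) : (2 <= d)%N ->
  0 < C_P_as R d <= d%:R * (d%:R ^+ 2 + 2) / 12.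
Proof.
move=> d2; rewrite /C_P_as -signr_odd.
have n1 : 1 <= (d./2)%:R :> R by rewrite ler1n half_gt0.
have dE : d%:R = (odd d)%:R + 2 * (d./2)%:R :> R.
  by rewrite -[in LHS](odd_double_half d) natrD -mul2n natrM.
move: (d./2)%:R n1 dE => n n1 ->; case: (odd d); rewrite ?expr1 ?expr0 /=; apply/andP; split.
- have -> : n * (n - 1) * (2 * n - 1) / 3 + (3 - -1) * n ^+ 2 / 2 =
    n * (n + 1) * (2 * n + 1) / 3 by field.
  by rewrite divr_gt0// !mulr_gt0//; lra.
- rewrite -subr_ge0.
  have -> : (1 + 2 * n) * ((1 + 2 * n) ^+ 2 + 2) / 12 -
    (n * (n - 1) * (2 * n - 1) / 3 + (3 - -1) * n ^+ 2 / 2) = (1 + 2 * n) / 4 by field.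
  by rewrite divr_ge0//; lra.
- have -> : n * (n - 1) * (2 * n - 1) / 3 + (3 - 1) * n ^+ 2 / 2 =
    n * (2 * n ^+ 2 + 1) / 3 by field.
  have n0 : 0 < n by lra.
  by rewrite divr_gt0// mulr_gt0// addr_gt0// mulr_gt0// exprn_gt0.
- rewrite -subr_ge0.
  have -> : (0 + 2 * n) * ((0 + 2 * n) ^+ 2 + 2) / 12 -
    (n * (n - 1) * (2 * n - 1) / 3 + (3 - 1) * n ^+ 2 / 2) = 0 by field.
  by [].
Qed.

(** Take [a = (d ^+ 2 - 2) / 4]: the Hardy term gets the coefficient
    [(d ^+ 2 - 2) ^+ 2 / 16], at the cost of [c' * V]. The case [a = 0] bounds [V] by
    [D / E]. The claim is then that [c' / E] is at most [c_d / C_P_as]. This holds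
    although [E] can be smaller than [C_P_as], because [c'] is smaller than [c_d] in
    at least the same proportion. *)
Lemma hardy_constant_le (d : nat) (X V D : R) : (2 <= d)%N ->
  (forall a : R, 0 <= a -> a * (d%:R ^+ 2 / 2 - 1 - a) * X +
     (d%:R * (d%:R ^+ 2 - 1) / 12 - a * d%:R + a * (a + 1) / d%:R) * V <= D) ->
  0 <= V -> 0 <= D -> C_T_as R d * X <= D.
Proof.
move=> d2 H V0 D0; have /andP[P0 PN] := C_P_as_bounds d2.
rewrite /C_T_as /c_d; move: (C_P_as R d) P0 PN => P P0 PN.
have N2 : 2 <= d%:R :> R by rewrite ler_nat.
move: (d%:R : R) H PN N2 => N H PN N2.
have N0 : 0 < N by lra.
have N4 : 4 <= N ^+ 2 by nra.
pose E := N * (N ^+ 2 - 1) / 12.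
pose c' := (5 * N ^+ 4 - 20 * N ^+ 2 + 12) / (48 * N).
set c := (48 * N)^-1 * _.
have E0 : 0 < E by rewrite /E divr_gt0// mulr_gt0//; lra.
have c'0 : 0 <= c'.
  rewrite /c'; apply: divr_ge0; last by apply: mulr_ge0 => //; exact: ltW.
  have -> : 5 * N ^+ 4 - 20 * N ^+ 2 + 12 = 5 * N ^+ 2 * (N ^+ 2 - 4) + 12 by ring.
  by rewrite addr_ge0// mulr_ge0 ?subr_ge0// mulr_ge0// sqr_ge0.
have EV : E * V <= D.
  by have := H 0 (lexx _); rewrite !mul0r subr0 addr0 add0r.
have AX : (N ^+ 2 - 2) ^+ 2 / 16 * X - c' * V <= D.
  (* the maximiser of [a * (N ^+ 2 / 2 - 1 - a)] *)
  have a0 : 0 <= (N ^+ 2 - 2) / 4 by lra.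
  apply: le_trans (H _ a0); rewrite le_eqVlt; apply/orP; left; apply/eqP.
  by rewrite /c'; field; rewrite lt0r_neq0.
have cc : c' * P <= c * E.
  apply: (@le_trans _ _ (c' * (N * (N ^+ 2 + 2) / 12))); first by rewrite ler_wpM2l.
  rewrite -subr_ge0.
  have -> : c * E - c' * (N * (N ^+ 2 + 2) / 12) =
    (6 * N ^+ 6 - 39 * N ^+ 4 + 78 * N ^+ 2 - 36 + 12 * N * (N ^+ 2 - 1)) / 576.
    by rewrite /c /c' /E; field; rewrite lt0r_neq0.
  apply: divr_ge0; last exact: ler0n.
  (* complete the square in [N ^+ 2]; the remainder is positive for [2 <= N] *)
  have -> : 6 * N ^+ 6 - 39 * N ^+ 4 + 78 * N ^+ 2 - 36 + 12 * N * (N ^+ 2 - 1) =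
     6 * (N ^+ 2 * (N ^+ 2 - 13 / 4) ^+ 2) + (117 / 8 * N ^+ 2 - 36)
     + 12 * (N * (N ^+ 2 - 1)) by field.
  have : 0 <= N ^+ 2 * (N ^+ 2 - 13 / 4) ^+ 2 by rewrite mulr_ge0 ?sqr_ge0.
  have : 0 <= N * (N ^+ 2 - 1) by rewrite mulr_ge0 ?subr_ge0; lra.
  lra.
have cEP : c' / E <= c / P by rewrite ler_pdivrMr// mulrAC ler_pdivlMr.
have D1 : (N ^+ 2 - 2) ^+ 2 / 16 * X <= (1 + c / P) * D.
  have : c' * V <= c' / E * D.
    by rewrite -mulrA ler_wpM2l// mulrC ler_pdivlMr// mulrC.
  have : c' / E * D <= c / P * D by rewrite ler_wpM2r.
  rewrite mulrDl mul1r; move: AX.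
  move: (c' * V) (c' / E * D) (c / P * D) (_ * X) => t1 t2 t3 t4; lra.
have s0 : 0 < 1 + c / P.
  by rewrite ltr_pwDl//; apply: le_trans cEP; rewrite divr_ge0// ltW.
by rewrite mulrAC ler_pdivrMr// [D * _]mulrC.
Qed.

End constants.

Section complex_components.
Context {R : realType} {d : nat}.
Variable psi : 'rV[R]_d -> R[i].
Hypothesis psi_smooth : smooth_ccube psi.
Hypothesis psi_per : periodic_pderivs psi.

Lemma sqnormE (z : R[i]) : sqnorm z = complex.Re z ^+ 2 + complex.Im z ^+ 2.
Proof. by case: z => a b; rewrite /sqnorm/= sqr_sqrtr// addr_ge0 ?sqr_ge0. Qed.

(** Real and imaginary parts satisfy the hypotheses separately, and both sides of
    the inequality are additive over them. *)
Lemma components_C1_periodic : exists g : 'I_d -> 'rV[R]_d -> R[i],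
  [/\ C1_periodic (fun x => complex.Re (psi x)) (fun j x => complex.Re (g j x)),
      C1_periodic (fun x => complex.Im (psi x)) (fun j x => complex.Im (g j x)) &
      forall j x, cube x -> pderiv j psi x = g j x].
Proof.
have [[cre cim] sm] := psi_smooth.
have /choice[g gP] : forall j, exists g, ccube_extension (pderiv j psi) g.
  by move=> j; have [_] := sm [:: j].
have per i x : ccube x -> psi (set_coord x i (- pi)) = psi (set_coord x i pi).
  exact: (psi_per (s := [::])).
have [der _] := sm [::].
exists g; split.
- split=> // [j|x j cx|x j cx|x j cx].
  + by have [[]] := gP j.
  + exact: (der x j cx).1.
  + by have [_ /(_ x cx) <-] := gP j.
  + by rewrite per.
- split=> // [j|x j cx|x j cx|x j cx].
  + by have [[]] := gP j.
  + exact: (der x j cx).2.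
  + by have [_ /(_ x cx) <-] := gP j.
  + by rewrite per.
- by move=> j x cx; have [_ /(_ x cx)] := gP j.
Qed.

End complex_components.

Lemma sum_sin_half_sqr (R : realType) d (x : 'rV[R]_d) :
  \sum_(j < d) sin (x ord0 j / 2) ^+ 2 = hardy_weight x.
Proof. by apply: eq_bigr => j _; have [_ ->] := half_angle (x ord0 j); field. Qed.

Theorem theorem1p5 (R : realType) (d : nat) (psi : 'rV[R]_d -> R[i]) :
  (2 <= d)%N ->
  smooth_ccube psi ->
  cube_Cintegral psi = 0 ->
  periodic_pderivs psi ->
  antisymmetric_ccube psi ->
  ((C_T_as R d)%:E *
     \int[lebesgue_rV R d]_(x in @cube R d)
       (sqnorm (psi x) / \sum_(j < d) sin (x ord0 j / 2) ^+ 2)%:E <=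
   \int[lebesgue_rV R d]_(x in @cube R d) (sqnorm_grad psi x)%:E)%E.
Proof.
move=> d2 sm _ per anti.
have [g [ug vg gE]] := components_C1_periodic sm per.
pose u x := complex.Re (psi x); pose v x := complex.Im (psi x).
have au (i j : 'I_d) x : i != j -> ccube x -> u (xcol i j x) = - u x.
  by move=> ij cx; rewrite /u anti//; case: (psi x).
have av (i j : 'I_d) x : i != j -> ccube x -> v (xcol i j x) = - v x.
  by move=> ij cx; rewrite /v anti//; case: (psi x).
have mQ := @measurable_cube R d.
pose I f : R := \int[lebesgue_rV R d]_(x in @cube R d) f x.
have IE f : (lebesgue_rV R d).-integrable (@cube R d) (EFin \o f) ->
    (\int[lebesgue_rV R d]_(x in @cube R d) (f x)%:E)%E = (I f)%:E.
  by move=> fi; rewrite /I /Rintegral fineK//; exact: integrable_fin_num.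
have iu := integrable_hardy d2 ug au; have iv := integrable_hardy d2 vg av.
have ig (w : 'rV[R]_d -> R) h : C1_periodic w h ->
   (lebesgue_rV R d).-integrable (@cube R d) (EFin \o (fun x => \sum_j h j x ^+ 2)).
  move=> wh; apply: within_integrable; apply: within_sum => j.
  exact: withinM (C1_grad_continuous wh (j := j)) (C1_grad_continuous wh (j := j)).
pose X := I (fun x => u x ^+ 2 / hardy_weight x) + I (fun x => v x ^+ 2 / hardy_weight x).
pose V := I (fun x => u x ^+ 2) + I (fun x => v x ^+ 2).
pose D := I (fun x => \sum_j complex.Re (g j x) ^+ 2) + I (fun x => \sum_j complex.Im (g j x) ^+ 2).
have -> : (\int[lebesgue_rV R d]_(x in @cube R d)
    (sqnorm (psi x) / \sum_(j < d) sin (x ord0 j / 2) ^+ 2)%:E = X%:E)%E.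
  rewrite /X EFinD -!IE// -integralD_EFin//; apply: eq_integral => x _.
  by rewrite sum_sin_half_sqr sqnormE mulrDl.
have -> : (\int[lebesgue_rV R d]_(x in @cube R d) (sqnorm_grad psi x)%:E = D%:E)%E.
  rewrite /D EFinD -!IE; [|exact: ig vg|exact: ig ug].
  rewrite -integralD_EFin//; [|exact: ig ug|exact: ig vg].
  apply: eq_integral => x; rewrite inE => cx; rewrite /= -EFinD -big_split/=.
  by congr (_%:E); apply: eq_bigr => j _; rewrite gE// sqnormE.
rewrite -EFinM lee_fin; apply: (@hardy_constant_le _ _ X V D) => // [a a0||].
- have := lerD (hardy_shifted d2 ug au a0) (hardy_shifted d2 vg av a0).
  apply: le_trans; rewrite /X /V -/(I _) -!/(I _); lra.
- by apply: addr_ge0; apply: Rintegral_ge0 => x _; exact: sqr_ge0.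
- apply: addr_ge0; apply: Rintegral_ge0 => x _.
    by apply: sumr_ge0 => j _; exact: sqr_ge0.
  by apply: sumr_ge0 => j _; exact: sqr_ge0.
Qed.
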